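(* Let $\mathbb X$ and $\mathbb Y$ be (real or complex) Hilbert spaces, $\Omega\subseteq\mathbb X$ an open set, and $F:\Omega\to\mathbb Y$ a continuously differentiable function such that $F'(x)$ has closed image for every $x\in\Omega$. Let $x_*\in\Omega$, $R>0$, $\beta:=\|F'(x_* )^{\dagger}\|$ and $\kappa:=\sup\{t\in[0,R): B(x_*,t)\subset\Omega\}$. Suppose that $F(x_* )=0$, that $F'(x_* )$ is injective, and that there exists a continuously differentiable $f:[0,R)\to\mathbb R$ such that $$\beta\,\|F'(x)-F'(x_*+\tau(x-x_* ))\|\le f'(\|x-x_*\|)-f'(\tau\|x-x_*\|)$$ for all $\tau\in[0,1]$ and $x\in B(x_*,\kappa)$, and such that (h1) $f(0)=0$ and $f'(0)=-1$; (h2) $f'$ is strictly increasing. Let $\nu:=\sup\{t\in[0,R): f'(t)<0\}$, $\rho:=\sup\{\delta\in(0,\nu): [f(t)/f'(t)-t]/t<1 \text{ for all } t\in(0,\delta)\}$, $r:=\min\{\kappa,\rho\}$ and $\sigma:=\sup\{t\in(0,\kappa): f(t)<0\}$. Let $x_0\in B(x_*,r)\setminus\{x_*\}$ and $t_0=\|x_0-x_*\|$. Then the sequences $\{x_k\}$ and $\{t_k\}$ given by $$x_{k+1}=x_k-F'(x_k)^{\dagger}F(x_k),\qquad t_{k+1}=|t_k-f(t_k)/f'(t_k)|,\qquad k=0,1,\ldots,$$ are well defined; $\{t_k\}$ is strictly decreasing, contained in $(0,r)$ and converges to $0$. Furthermore, $\{x_k\}$ is contained in $B(x_*,r)$ and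 converges to $x_*$, which is the unique zero of $F$ in $B(x_*,\sigma)$, and $$\lim_{k\to\infty}\frac{\|x_{k+1}-x_*\|}{\|x_k-x_*\|}=0,\qquad \lim_{k\to\infty}\frac{t_{k+1}}{t_k}=0.$$ Moreover, if $f(\rho)/(\rho f'(\rho))-1=1$ and $\rho<\kappa$, then $r=\rho$ is the best possible convergence radius; that is, for the same $R$, $f$ and $\kappa$ there exist Hilbert spaces, an open set, a function and a zero of it satisfying all the hypotheses above, together with a starting point at distance exactly $\rho$ from that zero, for which the sequence $\{x_k\}$ does not converge. If, additionally, for a given $0\le p\le1$, (h3) the function $(0,\nu)\ni t\mapsto[f(t)/f'(t)-t]/t^{p+1}$ is strictly increasing, then the sequence $\{t_{k+1}/t_k^{p+1}\}$ is strictly decreasing and $$\|x_{k+1}-x_*\|\le\big[t_{k+1}/t_k^{p+1}\big]\|x_k-x_*\|^{p+1}\le\big[t_1/t_0^{p+1}\big]\|x_k-x_*\|^{p+1},\qquad k=0,1,\ldots.$$ Consequently, for all $k\ge0$, $\|x_k-x_*\|\le t_0[t_1/t_0]^k$ if $p=0$, and $\|x_k-x_*\|\le t_0[t_1/t_0]^{((p+1)^k-1)/p}$ if $p\ne0$.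
   Context: $B(a,\delta)=\{x:\|x-a\|<\delta\}$ denotes the open ball. For a continuous injective linear operator $A:\mathbb X\to\mathbb Y$ with closed image, the Moore-Penrose inverse is $A^{\dagger}:=(A^*A)^{-1}A^*$, where $A^*$ is the adjoint. The quotient $\|x_{k+1}-x_*\|/\|x_k-x_*\|$ is read as $0$ if $x_k=x_*$ (in that case $x_{k+1}=x_*$ too). *)

(* Defs.v *)
From HB Require Import structures.
From mathcomp Require Import all_boot all_order all_algebra.
From mathcomp Require Import sesquilinear complex.
From mathcomp Require Import all_classical all_reals all_analysis.

Set Implicit Arguments.
Unset Strict Implicit.
Unset Printing Implicit Defensive.

Import Order.TTheory GRing.Theory Num.Theory.
Import numFieldNormedType.Exports.

Local Open Scope classical_set_scope.
Local Open Scope ring_scope.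

Variant scalar_kind := RealScalars | ComplexScalars.

Definition scalars (R : realType) (s : scalar_kind) : numFieldType :=
  match s with
  | RealScalars => R
  | ComplexScalars => R[i]
  end.

Definition scalar_conj (R : realType) (s : scalar_kind) :
    scalars R s -> scalars R s :=
  match s return scalars R s -> scalars R s with
  | RealScalars => fun x : R => x
  | ComplexScalars => @complex.conjc R
  end.

Fact scalar_conj_is_zmod_morphism (R : realType) (s : scalar_kind) :
  zmod_morphism (@scalar_conj R s).
Proof. by case: s => x y //=; rewrite rmorphB. Qed.

Fact scalar_conj_is_monoid_morphism (R : realType) (s : scalar_kind) :
  GRing.monoid_morphism (@scalar_conj R s).
Proof.
case: s; split => //.
- exact: (rmorph1 (@complex.conjc R)).
- exact: (rmorphM (@complex.conjc R)).
Qed.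

HB.instance Definition _ (R : realType) (s : scalar_kind) :=
  GRing.isZmodMorphism.Build _ _ (@scalar_conj R s)
    (@scalar_conj_is_zmod_morphism R s).
HB.instance Definition _ (R : realType) (s : scalar_kind) :=
  GRing.isMonoidMorphism.Build _ _ (@scalar_conj R s)
    (@scalar_conj_is_monoid_morphism R s).

Definition scalar_re (R : realType) (s : scalar_kind) : scalars R s -> R :=
  match s return scalars R s -> R with
  | RealScalars => fun x : R => x
  | ComplexScalars => @complex.Re R
  end.

Definition scalar_of_real (R : realType) (s : scalar_kind) : R -> scalars R s :=
  match s return R -> scalars R s with
  | RealScalars => fun x : R => x
  | ComplexScalars => fun x => complex.Complex x 0
  end.

(* The inner product is linear in its first argument. *)
HB.mixin Record CompleteNormedModule_isHilbert (R : realType) (s : scalar_kind)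
    V & CompleteNormedModule (scalars R s) V := {
  inner : {dot V for @scalar_conj R s};
  inner_norm : forall x : V, inner x x = `|x| ^+ 2
}.

#[short(type="hilbertType")]
HB.structure Definition Hilbert (R : realType) (s : scalar_kind) :=
  { V of CompleteNormedModule (scalars R s) V
       & CompleteNormedModule_isHilbert R s V }.

(* The library norm takes its values in the scalar field, hence in R[i] in the
   complex case; [normR] is the same number seen in [R]. *)
Definition normR (R : realType) (s : scalar_kind)
    (V : normedModType (scalars R s)) (x : V) : R := scalar_re `|x|.

Definition Ball (R : realType) (s : scalar_kind)
    (V : normedModType (scalars R s)) (a : V) (d : R) : set V :=
  [set x | normR (x - a) < d].

(* Meaningful for bounded linear [A] only ([sup] is 0 on unbounded sets). *)
Definition opnorm (R : realType) (s : scalar_kind)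
    (V W : normedModType (scalars R s)) (A : V -> W) : R :=
  sup [set normR (A x) | x in [set x : V | normR x <= 1]].

Section MoorePenrose.
Context {R : realType} {s : scalar_kind} {X Y : hilbertType R s}.
Implicit Type A : X -> Y.

(* By the Riesz representation theorem, such a [z] exists and is unique for
   every [y] as soon as [A] is linear and continuous. *)
Definition adjoint A (y : Y) : X :=
  xget 0 [set z : X | forall x : X, inner (A x) y = inner x z].

(* (A^* A)^{-1} A^*, for [A] linear, continuous, injective, of closed image, in
   which case A^* A is bijective and ['pinv_] is its inverse. *)
Definition mp_inverse A : Y -> X :=
  'pinv_(fun=> 0) setT (adjoint A \o A) \o adjoint A.

End MoorePenrose.

Definition is_derive_within (R : realType) (D : set R) (f : R -> R) (t l : R) :=
  (f u - f t) / (u - t) @[u --> within D t^'] --> l.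

Definition is_C1_ico (R : realType) (a : R) (f f' : R -> R) : Prop :=
  (forall t, t \in `[0, a[ -> is_derive_within `[0, a[ f t (f' t)) /\
  {within `[0, a[, continuous f'}.

Definition is_C1_on (R : realType) (s : scalar_kind)
    (X Y : normedModType (scalars R s)) (Omega : set X) (F : X -> Y) : Prop :=
  forall x, Omega x -> differentiable F x /\
    opnorm ('d F y \- 'd F x) @[y --> x] --> (0 : R).

Definition kappa_of (R : realType) (s : scalar_kind)
    (X : normedModType (scalars R s)) (Omega : set X) (xs : X) (a : R) : R :=
  sup [set t | 0 <= t < a /\ Ball xs t `<=` Omega].

Definition nu_of (R : realType) (a : R) (f' : R -> R) : R :=
  sup [set t | 0 <= t < a /\ f' t < 0].

Definition rho_of (R : realType) (a : R) (f f' : R -> R) : R :=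
  sup [set d | 0 < d < nu_of a f' /\
               forall t, 0 < t < d -> (f t / f' t - t) / t < 1].

Definition sigma_of (R : realType) (kappa : R) (f : R -> R) : R :=
  sup [set t | 0 < t < kappa /\ f t < 0].

(* [F] and [f] are total functions of which only the values on [Omega] and on
   [0, a) matter; [f'] is the derivative of [f] on [0, a), one-sided at 0. *)
Record majorant_setting (R : realType) (s : scalar_kind) (X Y : hilbertType R s)
    (Omega : set X) (F : X -> Y) (xs : X) (a : R) (f f' : R -> R) : Prop := {
  ms_open : open Omega;
  ms_C1 : is_C1_on Omega F;
  ms_closed_image : forall x, Omega x -> closed (range ('d F x));
  ms_mem : Omega xs;
  ms_radius_gt0 : 0 < a;
  ms_zero : F xs = 0;
  ms_injective : injective ('d F xs);
  ms_majorant_C1 : is_C1_ico a f f';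
  ms_majorant : forall (tau : R) (x : X), 0 <= tau <= 1 ->
    Ball xs (kappa_of Omega xs a) x ->
    opnorm (mp_inverse ('d F xs)) *
      opnorm ('d F x \- 'd F (xs + scalar_of_real s tau *: (x - xs)))
    <= f' (normR (x - xs)) - f' (tau * normR (x - xs));
  ms_h1 : f 0 = 0 /\ f' 0 = -1;
  ms_h2 : {in `[0, a[ &, {homo f' : t u / t < u}}
}.

Definition gauss_newton (R : realType) (s : scalar_kind) (X Y : hilbertType R s)
    (F : X -> Y) (x0 : X) (k : nat) : X :=
  iter k (fun x => x - mp_inverse ('d F x) (F x)) x0.

Definition majorant_seq (R : realType) (f f' : R -> R) (t0 : R) (k : nat) : R :=
  iter k (fun t => `|t - f t / f' t|) t0.

(* All iterates belong to [Omega] and have an injective derivative, so that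
   the Moore-Penrose inverse used at each step exists. *)
Definition gauss_newton_well_defined (R : realType) (s : scalar_kind)
    (X Y : hilbertType R s) (Omega : set X) (F : X -> Y) (x0 : X) : Prop :=
  forall k, Omega (gauss_newton F x0 k) /\
            injective ('d F (gauss_newton F x0 k)).

Definition majorant_seq_well_defined (R : realType) (a : R) (f f' : R -> R)
    (t0 : R) : Prop :=
  forall k, 0 <= majorant_seq f f' t0 k < a /\
            f' (majorant_seq f f' t0 k) != 0.

(* Main.v *)
Require Import Defs.
From HB Require Import structures.
From mathcomp Require Import all_boot all_order all_algebra.
From mathcomp Require Import all_classical all_reals all_analysis.
From mathcomp Require Import sesquilinear complex ring lra.

Set Implicit Arguments.
Unset Strict Implicit.
Unset Printing Implicit Defensive.

Import Order.TTheory GRing.Theory Num.Theory.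
Import numFieldNormedType.Exports.

Local Open Scope classical_set_scope.
Local Open Scope ring_scope.

(** The theorem rests on one inequality. Write [t] for the distance from [x] to
    the zero [xs] and [beta] for the norm of the Moore-Penrose inverse of
    [F'(xs)]. The majorant condition says that, up to the factor [beta], [F']
    varies along the segment from [xs] to [x] no more than [f'] varies on
    [[0, t]]; integrated, it bounds [beta] times the remainder of the
    linearisation of [F] at [x] by the corresponding remainder [t * f' t - f t]
    of [f] ([linearization_remainder_le]). It also gives
    [- f' t * |v| <= beta * |F'(x) v|], so that the Moore-Penrose inverse of
    [F'(x)] has norm at most [beta / - f' t]. The product of the two bounds is
    [f t / f' t - t], the length of the Newton iterate of [f] at [t]: a
    Gauss-Newton step moves [x] at least as close to [xs] as a Newton step moves
    [t] to 0 ([gauss_newton_step_le]).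

    The rest of the convergence statement concerns sequences of nonnegative
    numbers with [u k.+1 <= f (u k) / f' (u k) - u k]. Below [rho] the right-hand
    side is less than [u k], so that [u] decreases and, by continuity, cannot have
    a positive limit ([contraction_cvg0]); it is [o(u k)] since [f t / t] and
    [f' t] both tend to -1 ([contraction_superlinear]). Both the majorant sequence
    and the errors of the Gauss-Newton iterates are of this kind. If the
    quotients of [f t / f' t - t] by the power [p + 1] of [t] increase, the majorant
    sequence dominates the errors and the step inequality turns into explicit rates
    ([linear_rate], [power_rate]). Linearising at [xs] instead of [x] shows that
    another zero at distance [u] would force [f u >= 0], which convexity forbids
    below [sigma] ([zero_unique]).

    Norms of Moore-Penrose inverses make sense only if these are bounded. The
    Riesz representation theorem on a closed subspace, proved by minimisation
    ([riesz_on]), yields adjoints and orthogonal projections, hence the normal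
    equations that characterise the Moore-Penrose inverse. That an injective
    operator of closed range is bounded below ([bounded_below]) follows from the
    uniform boundedness principle ([weakly_bounded_normR]), applied to the vectors
    of the range whose image under the adjoint lies in the unit ball.

    The radius is sharp because the odd extension of [f] to the real line is its
    own extremal example: its derivative at [x] is [f' `|x|], and if
    [f rho / f' rho = 2 * rho], then Newton's method exchanges [rho] and [- rho]
    forever ([gauss_newton_oscillates]). *)

(** * Real norms and inner products over either scalar field *)

Section Scalars.
Context {R : realType} {s : scalar_kind}.
Local Notation K := (scalars R s).
Implicit Types (c d : R) (z w : K).
Local Notation "c %:S" := (scalar_of_real s c) (at level 2, format "c %:S").

Lemma scalar_reD z w : scalar_re (z + w) = scalar_re z + scalar_re w.
Proof. by move: z w; case: s => //= -[a b] [a' b']. Qed.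

Lemma scalar_reN z : scalar_re (- z) = - scalar_re z.
Proof. by move: z; case: s => //= -[a b]. Qed.

Lemma scalar_of_realK c : scalar_re c%:S = c.
Proof. by case: s. Qed.

Lemma scalar_of_realD c d : (c + d)%:S = c%:S + d%:S.
Proof. by case: s => //=; congr (Complex _ _); rewrite addr0. Qed.

Lemma scalar_of_real0 : 0%:S = 0 :> K.
Proof. by case: s. Qed.

Lemma scalar_of_real1 : 1%:S = 1 :> K.
Proof. by case: s. Qed.

Lemma scalar_of_realM c d : (c * d)%:S = c%:S * d%:S.
Proof.
by case: s => //=; congr (Complex _ _); rewrite ?(mulr0, mul0r) ?subr0 ?addr0.
Qed.

Lemma scalar_reZ c z : scalar_re (c%:S * z) = c * scalar_re z.
Proof. by move: z; case: s => //= -[a b] /=; rewrite mul0r subr0. Qed.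

Lemma scalar_of_real_le c d : (c%:S <= d%:S) = (c <= d).
Proof. by case: s => //=; rewrite lecR. Qed.

Lemma scalar_of_real_lt c d : (c%:S < d%:S) = (c < d).
Proof. by case: s => //=; rewrite ltcR. Qed.

Lemma ger0_scalarE z : 0 <= z -> z = (scalar_re z)%:S.
Proof.
move: z; case: s => //= -[a b]; rewrite lecE /= => /andP[/eqP -> _].
by [].
Qed.

Lemma scalar_of_real_norm c : `|c%:S| = `|c|%:S.
Proof.
case: s => //=; rewrite normc_def /= expr0n /= addr0 sqrtr_sqr.
by [].
Qed.

Lemma scalar_re_conj z : scalar_re (scalar_conj z) = scalar_re z.
Proof. by move: z; case: s => //= -[a b]. Qed.

(** The factors 1 and the imaginary unit recover both parts of a scalar, so that
    identities between scalars can be proved on real parts. *)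
Lemma scalar_re_inj z w :
  (forall k : K, scalar_re (k * z) = scalar_re (k * w)) -> z = w.
Proof.
move: z w; case: s => /= [z w /(_ 1)|]; first by rewrite !mul1r.
move=> [a b] [a' b'] h; have := h (Complex 1 0); have := h (Complex 0 1).
rewrite /= !(mul0r, mul1r, subr0, sub0r) => /oppr_inj -> ->; by [].
Qed.

End Scalars.
Local Notation "c %:S" := (scalar_of_real _ c) (at level 2, format "c %:S").

Lemma ler_epsilon (R : realType) (x y : R) :
  (forall e : R, 0 < e -> x <= y + e) -> x <= y.
Proof. by move=> h; apply/ler_addgt0Pr. Qed.

Section Norm.
Context {R : realType} {s : scalar_kind} {V : normedModType (scalars R s)}.
Implicit Types (c d : R) (u v w : V).

Lemma norm_normR v : `|v| = (normR v)%:S.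
Proof. exact: ger0_scalarE. Qed.

Lemma normR_ge0 v : 0 <= normR v.
Proof.
by rewrite -(@scalar_of_real_le R s) -norm_normR scalar_of_real0.
Qed.
Hint Resolve normR_ge0 : core.

Lemma normR0 : normR (0 : V) = 0.
Proof. by rewrite /normR normr0 -(@scalar_of_real0 R s) scalar_of_realK. Qed.

Lemma normR_eq0 v : normR v = 0 -> v = 0.
Proof.
by move=> h; apply/eqP; rewrite -normr_eq0 norm_normR h scalar_of_real0.
Qed.

Lemma normR_gt0 v : v != 0 -> 0 < normR v.
Proof.
by move=> h; rewrite lt_def normR_ge0 andbT; apply: contraNN h => /eqP/normR_eq0/eqP.
Qed.

Lemma normRN v : normR (- v) = normR v.
Proof. by rewrite /normR normrN. Qed.

Lemma normRB u v : normR (u - v) = normR (v - u).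
Proof. by rewrite -normRN opprB. Qed.

Lemma normRD u v : normR (u + v) <= normR u + normR v.
Proof.
by rewrite -(@scalar_of_real_le R s) scalar_of_realD -!norm_normR ler_normD.
Qed.

Lemma normRZ c v : normR (c%:S *: v) = `|c| * normR v.
Proof.
by rewrite /normR normrZ norm_normR scalar_of_real_norm scalar_reZ scalar_of_realK.
Qed.

Lemma nbhs_BallP (x : V) (A : set V) :
  nbhs x A <-> exists2 e : R, 0 < e & Ball x e `<=` A.
Proof.
split=> [/nbhs_ballP[e /= e0]|[e e0 sub]].
  rewrite -ball_normE => sub.
  have eE := ger0_scalarE (ltW e0); exists (scalar_re e).
    by rewrite -(@scalar_of_real_lt R s) -eE scalar_of_real0.
  move=> y yx; apply: sub; rewrite /ball_ /= norm_normR eE scalar_of_real_lt.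
  by rewrite normRB.
apply/nbhs_ballP; exists e%:S => /=.
  by rewrite -[ltLHS](@scalar_of_real0 R s) scalar_of_real_lt.
rewrite -ball_normE => y; rewrite /ball_ /= norm_normR scalar_of_real_lt => yx; apply: sub.
by rewrite /Ball /= normRB.
Qed.

Lemma cvg_normRP (T : Type) (F : set_system T) {FF : Filter F} (u : T -> V) (l : V) :
  (u @ F --> l) <-> (normR (u x - l) @[x --> F] --> (0 : R)).
Proof.
split=> [ul|ul].
  apply/cvgrPdist_lt => e e0.
  have : nbhs l (Ball l e) by apply/nbhs_BallP; exists e.
  move=> /ul hu; apply: (@filterS _ F FF _ _ _ hu) => x; rewrite /= /Ball /=.
  by rewrite sub0r normrN ger0_norm.
move=> A /nbhs_BallP[e e0 sub].
move/cvgrPdist_lt : ul => /(_ e e0) hu; apply: (@filterS _ F FF _ _ _ hu) => x.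
rewrite sub0r normrN ger0_norm // => h; exact: sub.
Qed.

Lemma cvgn_normRP (u : nat -> V) (l : V) :
  (u k @[k --> \oo] --> l) <->
  (forall e : R, 0 < e -> exists N, forall k, (N <= k)%N -> normR (u k - l) < e).
Proof.
rewrite cvg_normRP; split.
  move=> /cvgrPdist_lt h e /h [N _ hN]; exists N => k Nk.
  by have := hN k Nk; rewrite /= sub0r normrN ger0_norm.
move=> h; apply/cvgrPdist_lt => e /h[N hN]; exists N => // k Nk /=.
by rewrite sub0r normrN ger0_norm // hN.
Qed.

Lemma closed_seq_mem (M : set V) (u : nat -> V) (l : V) :
  closed M -> (forall n, M (u n)) -> u k @[k --> \oo] --> l -> M l.
Proof.
move=> cM Mu ul; by apply: (closed_cvg _ cM _ _ ul); exact: nearW.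
Qed.

End Norm.
#[global] Hint Extern 0 (is_true (0 <= normR _)) => exact: normR_ge0 : core.

Lemma cauchy_seq_cvg (R : realType) (s : scalar_kind)
    (V : completeNormedModType (scalars R s)) (u : nat -> V) :
  (forall e : R, 0 < e -> exists N, forall m n, (N <= m)%N -> (N <= n)%N ->
     normR (u m - u n) < e) ->
  exists l : V, u k @[k --> \oo] --> l.
Proof.
move=> h; suff : cvgn u by move=> /cvg_ex.
apply: cauchy_cvg; apply: cauchy_exP => e e0.
have eE := ger0_scalarE (ltW e0).
have e0' : 0 < scalar_re e.
  by rewrite -(@scalar_of_real_lt R s) -eE scalar_of_real0.
have [N hN] := h _ e0'; exists (u N), N => // k Nk /=.
by rewrite -ball_normE /ball_ /= norm_normR eE scalar_of_real_lt hN //=.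
Qed.

Section Inner.
Context {R : realType} {s : scalar_kind} {V : hilbertType R s}.
Implicit Types (c d : R) (u v w : V).

(** With the real part of its inner product, [V] is a real inner product space
    with the same norm, whichever its scalars. *)
Definition rip u v : R := scalar_re (inner u v).

Lemma ripDl u v w : rip (u + v) w = rip u w + rip v w.
Proof. by rewrite /rip linearDl scalar_reD. Qed.

Lemma ripDr u v w : rip w (u + v) = rip w u + rip w v.
Proof. by rewrite /rip linearDr scalar_reD. Qed.

Lemma ripNl u w : rip (- u) w = - rip u w.
Proof. by rewrite /rip linearNl scalar_reN. Qed.

Lemma ripNr u w : rip w (- u) = - rip w u.
Proof. by rewrite /rip linearNr scalar_reN. Qed.

Lemma rip0l u : rip 0 u = 0.
Proof. by rewrite -(subrr 0) ripDl ripNl subrr. Qed.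

Lemma ripC u v : rip u v = rip v u.
Proof.
rewrite /rip (@hermitian_subproof _ _ _ _ (@inner R s V)) expr0 mul1r.
by rewrite scalar_re_conj.
Qed.

Lemma ripZl c u v : rip (c%:S *: u) v = c * rip u v.
Proof. by rewrite /rip linearZl_LR scalar_reZ. Qed.

Lemma ripZr c u v : rip u (c%:S *: v) = c * rip u v.
Proof. by rewrite ripC ripZl ripC. Qed.

Lemma rip_normR u : rip u u = normR u ^+ 2.
Proof.
rewrite /rip inner_norm norm_normR !expr2.
by rewrite -scalar_of_realM scalar_of_realK.
Qed.

Lemma normR_sqrD u v : normR (u + v) ^+ 2 = normR u ^+ 2 + rip u v *+ 2 + normR v ^+ 2.
Proof.
rewrite -!rip_normR !(ripDl, ripDr) (ripC v u); ring.
Qed.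

Lemma normR_sqrB u v : normR (u - v) ^+ 2 = normR u ^+ 2 - rip u v *+ 2 + normR v ^+ 2.
Proof. by rewrite normR_sqrD ripNr normRN mulNrn. Qed.

Lemma rip_le u v : rip u v <= normR u * normR v.
Proof.
have [/normR_eq0 -> |u0] := eqVneq (normR u) 0.
  by rewrite normR0 mul0r rip0l.
have [/normR_eq0 -> |v0] := eqVneq (normR v) 0.
  by rewrite normR0 mulr0 ripC rip0l.
have {}u0 : 0 < normR u by rewrite lt_def u0 normR_ge0.
have {}v0 : 0 < normR v by rewrite lt_def v0 normR_ge0.
have := sqr_ge0 (normR ((normR v)%:S *: u - (normR u)%:S *: v)).
rewrite normR_sqrB !normRZ ripZl ripZr !gtr0_norm // => h.
have : 0 < normR u * normR v by rewrite mulr_gt0.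
move: h; set x := rip u v; set a := normR u; set b := normR v => h ab.
have {h} : 0 <= (a * b) * (a * b - x) by rewrite mulr2n in h; nra.
by rewrite pmulr_rge0 // subr_ge0.
Qed.

Lemma rip_norm_le u v : `|rip u v| <= normR u * normR v.
Proof.
rewrite ler_norml rip_le andbT; have := rip_le (- u) v.
by rewrite ripNl normRN lerNl.
Qed.

Lemma rip_eq0 u : rip u u = 0 -> u = 0.
Proof.
by rewrite rip_normR => /eqP; rewrite expf_eq0 /= => /eqP/normR_eq0.
Qed.

End Inner.

Section Bounded.
Context {R : realType} {s : scalar_kind} {V W : normedModType (scalars R s)}.

(** Rescaling to the unit ball takes real factors only, even over the complex
    numbers. *)
Definition real_homogeneous (A : V -> W) :=
  forall (c : R) v, A (c%:S *: v) = c%:S *: A v.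

Definition bounded_by (C : R) (A : V -> W) := forall v, normR (A v) <= C * normR v.

Lemma linear_continuous_bounded (A : {linear V -> W}) :
  continuous A -> exists2 C : R, 0 <= C & bounded_by C A.
Proof.
move=> /(_ 0) cA; have : nbhs (A 0) (Ball (A 0) 1) by apply/nbhs_BallP; exists 1.
move=> /cA; rewrite nbhs_simpl => /nbhs_BallP[e e0 sub].
exists (2 / e); first by rewrite divr_ge0 // ltW.
move=> v; have [->|v0] := eqVneq v 0.
  by rewrite linear0 !normR0 mulr0.
have nv := normR_gt0 v0.
set c := e / (2 * normR v).
have c0 : 0 < c by rewrite divr_gt0 // mulr_gt0.
have /sub : Ball 0 e (c%:S *: v).
  rewrite /Ball /= subr0 normRZ gtr0_norm // /c.
  by rewrite invfM mulrA divfK ?gt_eqF // ltr_pdivrMr //; lra.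
rewrite /Ball /= linear0 subr0 linearZ /= normRZ gtr0_norm //.
rewrite mulrC -ltr_pdivlMr // => /ltW /le_trans; apply.
by rewrite /c div1r invf_div mulrAC.
Qed.

Lemma opnorm_bound (A : V -> W) (C : R) : real_homogeneous A -> bounded_by C A ->
  bounded_by (opnorm A) A.
Proof.
move=> hA hC v; have [->|v0] := eqVneq v 0.
  have := hA 0 0; rewrite scaler0 (@scalar_of_real0 R s) scale0r => ->.
  by rewrite !normR0 mulr0.
have nv := normR_gt0 v0; rewrite -ler_pdivrMr //.
apply: ub_le_sup.
  exists `|C| => _ [x /= x1 <-]; apply: (le_trans (hC x)).
  rewrite (le_trans (ler_norm _)) // normrM (ger0_norm (normR_ge0 x)).
  by rewrite ler_piMr.
exists ((normR v)^-1%:S *: v) => /=.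
  by rewrite normRZ gtr0_norm ?invr_gt0 // mulVf // gt_eqF.
by rewrite hA normRZ gtr0_norm ?invr_gt0 // mulrC.
Qed.

(** The supremum of an unbounded set is 0 by convention. *)
Lemma opnorm_ge0 (A : V -> W) : 0 <= opnorm A.
Proof.
have [h|h] := pselect (has_ubound [set normR (A x) | x in [set x : V | normR x <= 1]]).
  apply: (le_trans (normR_ge0 (A 0))); apply: ub_le_sup => //.
  by exists 0 => //=; rewrite normR0.
by rewrite /opnorm sup_out // => -[].
Qed.

Lemma opnorm_le (A : V -> W) (C : R) : 0 <= C -> bounded_by C A -> opnorm A <= C.
Proof.
move=> C0 hC; apply: ge_sup.
  by exists (normR (A 0)), 0 => //=; rewrite normR0.
move=> _ [x /= x1 <-]; apply: (le_trans (hC x)); by rewrite ler_piMr.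
Qed.

Lemma bounded_byB (A B : V -> W) C D :
  bounded_by C A -> bounded_by D B -> bounded_by (C + D) (A \- B).
Proof.
move=> hA hB v; rewrite /= mulrDl (le_trans (normRD _ _)) // normRN.
exact: lerD.
Qed.

End Bounded.

(** * Riesz representation, Moore-Penrose inverses and the bounded inverse theorem *)

Lemma rip_ext (R : realType) (s : scalar_kind) (V : hilbertType R s) (x y : V) :
  (forall v, rip v x = rip v y) -> x = y.
Proof.
move=> h; apply/eqP; rewrite -subr_eq0; apply/eqP; apply: rip_eq0.
by rewrite ripDr ripNr h subrr.
Qed.

Lemma inv_nat_lt (R : realType) (e : R) : 0 < e -> exists n : nat, n.+1%:R^-1 < e.
Proof.
move=> e0; exists (Num.truncn e^-1); rewrite invf_plt ?posrE //.
by rewrite truncnS_gt.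
Qed.

(** Real scalars and limits of sequences suffice for minimisation arguments, over
    either field. *)
Record closed_subspace (R : realType) (s : scalar_kind) (V : hilbertType R s)
    (M : set V) : Prop := ClosedSubspace {
  csD : forall x y, M x -> M y -> M (x + y);
  csZ : forall (c : R) x, M x -> M (c%:S *: x);
  cs_lim : forall (u : nat -> V) l, (forall n, M (u n)) ->
    u k @[k --> \oo] --> l -> M l
}.

Section Riesz.
Context {R : realType} {s : scalar_kind} {V : hilbertType R s}.
Variables (M : set V) (phi : V -> R) (C : R).
Hypotheses (csM : closed_subspace M) (M0 : M 0).
Hypotheses (phiD : forall x y, phi (x + y) = phi x + phi y).
Hypotheses (phiZ : forall (c : R) x, phi (c%:S *: x) = c * phi x).
Hypothesis phi_le : forall x, `|phi x| <= C * normR x.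

Let J x := normR x ^+ 2 - 2 * phi x.

Let J_ge x : - C ^+ 2 <= J x.
Proof.
have h : phi x <= C * normR x by apply: le_trans (phi_le x); exact: ler_norm.
rewrite /J; have := sqr_ge0 (normR x - C); nra.
Qed.

(** The parallelogram identity, in terms of the functional to be minimised. *)
Let J_mid x y :
  normR (x - y) ^+ 2 = 2 * (J x + J y - 2 * J (2^-1%:S *: (x + y))).
Proof.
rewrite /J phiZ phiD normRZ ger0_norm ?invr_ge0 // exprMn.
have := normR_sqrB x y; have := normR_sqrD x y.
by move=> -> ->; field.
Qed.

Let I := inf [set J x | x in M].

Let I_le x : M x -> I <= J x.
Proof.
move=> Mx; apply: ge_inf; last by exists x.
by exists (- C ^+ 2) => _ [y _ <-].
Qed.

Let minimizing n : exists x, M x /\ J x < I + n.+1%:R^-1.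
Proof.
have hI : has_inf [set J x | x in M].
  by split; [exists (J 0), 0 | exists (- C ^+ 2) => _ [y _ <-]].
have e0 : 0 < (n.+1%:R^-1 : R) by rewrite invr_gt0.
by have [_ [x Mx <-] h] := inf_adherent e0 hI; exists x.
Qed.

(** A minimising sequence for [normR x ^+ 2 - 2 * phi x] on [M] is Cauchy by the
    parallelogram identity, and the first variation at its limit vanishes. *)
Lemma riesz_on : exists2 z, M z & forall x, M x -> rip x z = phi x.
Proof.
have [u hu] := choice minimizing.
have Mu n : M (u n) by case: (hu n).
have Ju n : J (u n) < I + n.+1%:R^-1 by case: (hu n).
have inv_le N n : (N <= n)%N -> (n.+1%:R^-1 : R) <= N.+1%:R^-1.
  by move=> Nn; rewrite lef_pV2 ?posrE // ler_nat.
have [e e0|z uz] := @cauchy_seq_cvg _ _ _ u.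
  have e4 : 0 < e ^+ 2 / 4 by rewrite divr_gt0 // exprn_gt0.
  have [N hN] := inv_nat_lt e4; exists N => m n Nm Nn.
  have Mmid : M (2^-1%:S *: (u m + u n)).
    by apply: csZ => //; apply: csD.
  have := J_mid (u m) (u n); have := I_le Mmid.
  have := Ju m; have := Ju n; have := inv_le _ _ Nm; have := inv_le _ _ Nn.
  move=> h1 h2 h3 h4 h5 h6.
  have : normR (u m - u n) ^+ 2 < e ^+ 2.
    move: h1 h2 h3 h4 h5 h6 hN.
    move: (n.+1%:R^-1) (m.+1%:R^-1) (N.+1%:R^-1) => a b c.
    move: (J (u m)) (J (u n)) (J _) (e ^+ 2) (normR _ ^+ 2) => p q r d g.
    lra.
  by rewrite ltr_pXn2r // nnegrE; [exact: normR_ge0|exact: ltW].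
have Mz : M z by apply: cs_lim Mu uz.
exists z => // x Mx.
have var (t : R) : 0 <= t ^+ 2 * normR x ^+ 2 + 2 * t * (rip x z - phi x).
  rewrite -[leRHS]subr0 subr_ge0; apply: ler_epsilon => e e0.
  have [K0 K1] : 0 < `|t| * normR x + 1 /\ 0 <= `|t| * normR x.
    have : 0 <= `|t| * normR x by rewrite mulr_ge0.
    by split=> //; lra.
  have /cvgn_normRP/(_ (e / (4 * (`|t| * normR x + 1)))) := uz.
  case; first by rewrite divr_gt0 // mulr_gt0.
  move=> N1 hN1; have [N2 hN2] := @inv_nat_lt R (e / 2) (divr_gt0 e0 (ltr0n _ 2)).
  pose n := maxn N1 N2.
  have := hN1 n (leq_maxl _ _); have := inv_le _ _ (leq_maxr N1 N2 : (N2 <= n)%N).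
  have := I_le (csD csM (Mu n) (csZ csM t Mx)).
  have := Ju n; rewrite /J normR_sqrD normRZ exprMn real_normK ?num_real //.
  rewrite ripZr phiD phiZ.
  have : `|t * rip (u n - z) x| <= (`|t| * normR x) * normR (u n - z).
    by rewrite normrM -mulrA ler_wpM2l // mulrC rip_norm_le.
  rewrite ripDl ripNl (ripC (u n)) (ripC z).
  rewrite ltr_pdivlMr ?mulr_gt0 // => /ler_normlP[_ h1] h2 h3 h4 h5.
  have d0 := normR_ge0 (u n - z).
  move: h1 h2 h3 h4 h5 d0 hN2 K1.
  move: (n.+1%:R^-1) (N2.+1%:R^-1) (normR (u n - z)) (`|t| * normR x) => a b d q.
  move: (normR (u n) ^+ 2) (normR x ^+ 2) (rip x (u n)) (rip x z) => un x2 ru rz.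
  move: (phi (u n)) (phi x) => pu px.
  move=> h1 h2 h3 h4 h5 d0 hb q0.
  have qd : q * d <= e / 4 by lra.
  lra.
apply/eqP; rewrite -subr_eq0; set D := rip x z - phi x in var *.
have x2 : 0 < normR x ^+ 2 + 1 by rewrite ltr_wpDl // sqr_ge0.
have := var (- D / (normR x ^+ 2 + 1)).
set q := normR x ^+ 2 in x2 *; have q0 : 0 <= q by rewrite sqr_ge0.
(* The choice t = - D / (q + 1) makes the variation negative unless D = 0. *)
have -> : (- D / (q + 1)) ^+ 2 * q + 2 * (- D / (q + 1)) * D =
  - (D ^+ 2 * ((q + 2) / (q + 1) ^+ 2)) by field; rewrite gt_eqF.
rewrite oppr_ge0 pmulr_lle0; last by rewrite divr_gt0 ?exprn_gt0 //; lra.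
by move=> h; rewrite -sqrf_eq0 eq_le h sqr_ge0.
Qed.

End Riesz.

Lemma closed_subspaceT (R : realType) (s : scalar_kind) (V : hilbertType R s) :
  closed_subspace (@setT V).
Proof. by []. Qed.

Section Adjoint.
Context {R : realType} {s : scalar_kind} {X Y : hilbertType R s}.
Variables (A : {linear X -> Y}) (C : R).
Hypothesis AC : bounded_by C A.

(** Real parts suffice: the factors [k] of [scalar_re_inj] are absorbed by the
    linearity of [A] and of the inner product. *)
Lemma adjointE x y : inner (A x) y = inner x (adjoint A y).
Proof.
rewrite /adjoint; case: xgetP => [z _ /= -> //|/= h]; exfalso.
have [|||||z _ hz] := @riesz_on R s X setT (fun x => rip (A x) y) (C * normR y).
- exact: closed_subspaceT.
- by [].
- by move=> u v; rewrite linearD ripDl.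
- by move=> c u; rewrite linearZ ripZl.
- by move=> v; rewrite (le_trans (rip_norm_le _ _)) // mulrAC ler_wpM2r.
apply: (h z) => x'; apply: scalar_re_inj => k.
by have := hz (k *: x') I; rewrite /rip linearZ !linearZl_LR.
Qed.

Lemma adjoint_rip x y : rip (A x) y = rip x (adjoint A y).
Proof. by rewrite /rip adjointE. Qed.

Lemma adjointD y z : adjoint A (y + z) = adjoint A y + adjoint A z.
Proof. by apply: rip_ext => v; rewrite ripDr -!adjoint_rip ripDr. Qed.

Lemma adjointZ (c : R) y : adjoint A (c%:S *: y) = c%:S *: adjoint A y.
Proof. by apply: rip_ext => v; rewrite ripZr -!adjoint_rip ripZr. Qed.

Lemma adjointB y z : adjoint A (y - z) = adjoint A y - adjoint A z.
Proof. by apply: rip_ext => v; rewrite ripDr ripNr -!adjoint_rip ripDr ripNr. Qed.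

Lemma adjoint0 : adjoint A 0 = 0.
Proof. by rewrite -[in LHS](subrr 0) adjointB subrr. Qed.

Lemma closed_subspace_range : closed (range A) -> closed_subspace (range A).
Proof.
move=> cA; split.
- by move=> _ _ [x _ <-] [y _ <-]; exists (x + y); rewrite ?linearD.
- by move=> c _ [x _ <-]; exists (c%:S *: x); rewrite ?linearZ.
- by move=> u l; exact: closed_seq_mem.
Qed.

Hypothesis injA : injective A.

(** The normal equations: [A x - y] is orthogonal to the range of [A]. *)
Lemma mp_inverse_unique y x :
  (forall v, rip (A v) (A x) = rip (A v) y) -> mp_inverse A y = x.
Proof.
move=> h; have AAx : (adjoint A \o A) x = adjoint A y.
  by apply: rip_ext => v; rewrite /= -!adjoint_rip h.
rewrite /mp_inverse /= -AAx pinvKV ?in_setE //.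
move=> u v _ _ /= uv; apply/injA/eqP; rewrite -subr_eq0 -linearB; apply/eqP/rip_eq0.
by rewrite adjoint_rip linearB adjointB uv subrr ripC rip0l.
Qed.

Lemma mp_inverseK x : mp_inverse A (A x) = x.
Proof. exact: mp_inverse_unique. Qed.

Hypothesis clA : closed (range A).

(** The orthogonal projection onto the range exists because the range is closed. *)
Lemma mp_inverse_normal y v : rip (A v) (A (mp_inverse A y)) = rip (A v) y.
Proof.
have [|||||_ [x _ <-] hx] := @riesz_on R s Y (range A) (fun m => rip m y) (normR y).
- exact: closed_subspace_range.
- by exists 0; rewrite ?linear0.
- by move=> u w; rewrite ripDl.
- by move=> c u; rewrite ripZl.
- by move=> m; rewrite mulrC rip_norm_le.
by rewrite (mp_inverse_unique (x := x)) => [|w]; apply: hx; [exists v|exists w].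
Qed.

Lemma mp_inverse_subl x y : mp_inverse A (A x - y) = x - mp_inverse A y.
Proof.
apply: mp_inverse_unique => v.
by rewrite linearB !ripDr !ripNr mp_inverse_normal.
Qed.

Lemma mp_inverse_homogeneous : real_homogeneous (mp_inverse A).
Proof.
by move=> c y; apply: mp_inverse_unique => v; rewrite linearZ !ripZr mp_inverse_normal.
Qed.

(** [A (mp_inverse A y)] is the orthogonal projection of [y] on the range of [A],
    so that its norm is at most that of [y]. *)
Lemma mp_inverse_bounded c : 0 <= c -> (forall x, normR x <= c * normR (A x)) ->
  bounded_by c (mp_inverse A).
Proof.
move=> c0 hc y; apply: (le_trans (hc _)); apply: ler_wpM2l => //.
set p := A _; have : normR p ^+ 2 <= normR p * normR y.
  by rewrite -rip_normR mp_inverse_normal rip_le.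
have := normR_ge0 y; have [->//|p0] := eqVneq (normR p) 0.
have : 0 < normR p by rewrite lt_def p0 normR_ge0.
by rewrite expr2 => p1 _; rewrite ler_pM2l.
Qed.

End Adjoint.

Section UniformBoundedness.
Context {R : realType} {s : scalar_kind} {V : hilbertType R s}.

Let expr3S n : 3 ^- n.+1 = 3 ^- n / 3 :> R.
Proof. by rewrite exprSr invfM. Qed.

Lemma geometric_steps_cvg (x : nat -> V) :
  (forall n, normR (x n.+1 - x n) <= (3 ^- n)) ->
  exists2 l, x k @[k --> \oo] --> l & forall n, normR (l - x n) <= 3 / 2 * 3 ^- n.
Proof.
move=> hx.
have step n k : normR (x (n + k)%N - x n) <= 3 / 2 * (3 ^- n - 3 ^- (n + k)).
  elim: k => [|k IH]; first by rewrite addn0 !subrr normR0 mulr0.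
  rewrite addnS -[x _.+1](subrK (x (n + k)%N)) -addrA.
  apply: (le_trans (normRD _ _)); apply: (le_trans (lerD (hx _) IH)).
  by rewrite expr3S; lra.
have step' n k : normR (x (n + k)%N - x n) <= 3 / 2 * 3 ^- n.
  apply: (le_trans (step n k)); rewrite ler_pM2l ?divr_gt0 // lerBlDr lerDl.
  by rewrite invr_ge0 exprn_ge0.
have small (e : R) : 0 < e -> exists n, 3 * 3 ^- n < e.
  move=> e0; have [n hn] := inv_nat_lt (divr_gt0 e0 (ltr0n R 3)).
  exists n; rewrite mulrC -ltr_pdivlMr //; apply: le_lt_trans hn.
  rewrite lef_pV2 ?posrE ?exprn_gt0 // -natrX ler_nat; exact: ltn_expl.
have [e e0|l xl] := @cauchy_seq_cvg _ _ _ x.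
  have [N hN] := small e e0; exists N => m n Nm Nn.
  have := step' N (m - N)%N; have := step' N (n - N)%N; rewrite !subnKC // => h1 h2.
  have := normRD (x m - x N) (x N - x n); rewrite addrA subrK (normRB (x N)); lra.
exists l => // n; apply: ler_epsilon => e e0.
have /cvgn_normRP/(_ e e0)[N hN] := xl.
have := hN (n + N)%N (leq_addl _ _); have := step' n N.
have := normRD (l - x (n + N)%N) (x (n + N)%N - x n); rewrite addrA subrK (normRB l (x (n + N)%N)); lra.
Qed.

(** The uniform boundedness principle, by Sokal's gliding hump: if [S] contained
    vectors [w n] of norm beyond [2 * 3 ^ n * n.+1], steps of length [3 ^- n]
    along [+- w n] would lead to a point of [M] at which the products with the
    [w n] are unbounded, the steps after [n] undoing at most half of the [n]-th. *)
Lemma weakly_bounded_normR (M S : set V) : closed_subspace M -> M 0 -> S `<=` M ->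
  (forall m, M m -> exists B : R, forall w, S w -> `|rip m w| <= B) ->
  exists2 B : R, 0 <= B & forall w, S w -> normR w <= B.
Proof.
move=> csM M0 SM wb; apply: contrapT => nb.
have big n : exists w, S w /\ 2 * 3 ^+ n * n.+1%:R < normR w.
  apply: contrapT => h; apply: nb; exists (2 * 3 ^+ n * n.+1%:R).
    by rewrite !mulr_ge0 // exprn_ge0.
  by move=> w Sw; rewrite leNgt; apply/negP => h'; apply: h; exists w.
have [w hw] := choice big.
have Sw n : S (w n) by case: (hw n).
have w_gt n : 2 * 3 ^+ n * n.+1%:R < normR (w n) by case: (hw n).
have w0 n : 0 < normR (w n).
  by apply: le_lt_trans (w_gt n); rewrite !mulr_ge0 // exprn_ge0.
(* The sign keeps the step from cancelling the product already accumulated. *)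
pose c n (x : V) : R := (if 0 <= rip x (w n) then 1 else -1) * (3 ^- n / normR (w n)).
pose x := fix x n := if n is k.+1 then x k + (c k (x k))%:S *: w k else (0 : V).
have Mx n : M (x n).
  by elim: n => // n IH /=; apply: csD => //; apply: csZ => //; apply: SM.
have c_norm n y : `|c n y| = 3 ^- n / normR (w n).
  rewrite /c normrM [X in _ * X]ger0_norm ?divr_ge0 ?invr_ge0 ?exprn_ge0 //.
  by case: ifP => _; rewrite ?normrN normr1 mul1r.
have [|l xl hl] := @geometric_steps_cvg x.
  move=> n /=; rewrite addrAC subrr add0r normRZ c_norm divfK //; by rewrite gt_eqF.
have Ml : M l by apply: cs_lim Mx xl.
have hump n : 3 ^- n * normR (w n) <= `|rip (x n.+1) (w n)|.
  rewrite /= ripDl ripZl rip_normR.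
  have e : c n (x n) * normR (w n) ^+ 2 =
      (if 0 <= rip (x n) (w n) then 1 else -1) * (3 ^- n * normR (w n)).
    by rewrite /c expr2 -!mulrA; congr (_ * (_ * _)); rewrite mulKf // gt_eqF.
  have p0 : 0 <= 3 ^- n * normR (w n) by rewrite mulr_ge0 // invr_ge0 exprn_ge0.
  rewrite e; case: ifPn => [r0|]; rewrite ?mul1r ?mulN1r.
    by rewrite ger0_norm ?addr_ge0 // lerDr.
  rewrite -ltNge => r0; rewrite ltr0_norm; last by lra.
  lra.
have [B hB] := wb _ Ml.
have far n : n.+1%:R <= B.
  apply: le_trans (hB _ (Sw n)).
  have := hump n; have := rip_norm_le (l - x n.+1) (w n).
  have : normR (l - x n.+1) <= 3 ^- n / 2.
    by apply: (le_trans (hl n.+1)); rewrite expr3S; lra.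
  rewrite ripDl ripNl => h1 h2 h3.
  have h4 : `|rip (x n.+1) (w n)| <= `|rip l (w n)| + `|rip l (w n) - rip (x n.+1) (w n)|.
    rewrite -{1}[rip (x n.+1) _](subKr (rip l (w n))) opprB addrC.
    by rewrite [leRHS]addrC distrC ler_normD.
  have h5 : normR (l - x n.+1) * normR (w n) <= 3 ^- n / 2 * normR (w n).
    by rewrite ler_wpM2r.
  have h6 : n.+1%:R <= 3 ^- n / 2 * normR (w n).
    rewrite mulrC -ler_pdivrMr ?divr_gt0 ?invr_gt0 ?exprn_gt0 // invf_div invrK.
    by apply: ltW; apply: le_lt_trans (w_gt n); lra.
  lra.
have := far (Num.truncn B); have := truncnS_gt B; lra.
Qed.

End UniformBoundedness.

Section BoundedBelow.
Context {R : realType} {s : scalar_kind} {X Y : hilbertType R s}.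
Variables (A : {linear X -> Y}) (C : R).
Hypotheses (AC : bounded_by C A) (injA : injective A) (clA : closed (range A)).

Let M := range A.

Let M0 : M 0. Proof. by exists 0; rewrite ?linear0. Qed.

Let csM : closed_subspace M. Proof. exact: closed_subspace_range. Qed.

(** The vectors of the range whose image under the adjoint lies in the unit ball
    are weakly bounded, since [rip (A v) w = rip v (adjoint A w)]. *)
Let adjoint_below : exists2 B : R, 0 <= B &
  forall w, M w -> normR w <= B * normR (adjoint A w).
Proof.
have [|||m [v _ <-]|B B0 hB] :=
  @weakly_bounded_normR _ _ _ M [set w | M w /\ normR (adjoint A w) <= 1].
- exact: csM.
- exact: M0.
- by move=> w [].
- exists (normR v) => w [_ w1]; rewrite (adjoint_rip AC).
  by rewrite (le_trans (rip_norm_le _ _)) // ler_piMr.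
exists B => // w Mw; have [a0|a0] := eqVneq (normR (adjoint A w)) 0.
  case: Mw => v _ vw; suff -> : w = 0 by rewrite normR0 mulr_ge0.
  apply: rip_eq0; rewrite -{1}vw (adjoint_rip AC) (normR_eq0 a0) ripC.
  by rewrite rip0l.
have a1 : 0 < normR (adjoint A w) by rewrite lt_def a0 normR_ge0.
rewrite -ler_pdivrMr // mulrC -[X in X * _]gtr0_norm ?invr_gt0 // -normRZ.
apply: hB; split; first exact: csZ.
by rewrite (adjointZ AC) normRZ gtr0_norm ?invr_gt0 // mulVf.
Qed.

(** The closure of the image of [M] under the adjoint has a trivial orthogonal
    complement, the kernel of [A]. *)
Let adjoint_dense x (e : R) : 0 < e -> exists2 w, M w & normR (x - adjoint A w) < e.
Proof.
move=> e0; pose N : set X := [set z | forall d : R, 0 < d ->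
  exists2 w, M w & normR (z - adjoint A w) < d].
have csN : closed_subspace N.
  split.
  - move=> u v Nu Nv d d0; have d2 : 0 < d / 2 by rewrite divr_gt0.
    have [w Mw hw] := Nu _ d2; have [w' Mw' hw'] := Nv _ d2.
    exists (w + w'); first exact: csD.
    rewrite (adjointD AC) opprD addrACA.
    by have := normRD (u - adjoint A w) (v - adjoint A w'); lra.
  - move=> c u Nu d d0; have c0 : 0 < `|c| + 1 by rewrite ltr_wpDl.
    have [w Mw hw] := Nu _ (divr_gt0 d0 c0); exists (c%:S *: w); first exact: csZ.
    rewrite (adjointZ AC) -scalerBr normRZ.
    rewrite ltr_pdivlMr // in hw; apply: le_lt_trans hw; rewrite mulrC.
    by apply: ler_wpM2l; [exact: normR_ge0|rewrite lerDl].
  - move=> u l Nu /cvgn_normRP ul d d0; have d2 : 0 < d / 2 by rewrite divr_gt0.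
    have [k /(_ k (leqnn k)) hk] := ul _ d2; have [w Mw hw] := Nu k _ d2.
    exists w => //; have := normRD (l - u k) (u k - adjoint A w).
    by rewrite addrA subrK (normRB l (u k)); lra.
have im w : M w -> N (adjoint A w).
  by move=> Mw d d0; exists w => //; rewrite subrr normR0.
have N0 : N 0.
  by rewrite -(adjoint0 AC); exact: im.
have [|||||z Nz hz] := @riesz_on R s X N (fun m => rip m x) (normR x).
- exact: csN.
- exact: N0.
- by move=> u w; rewrite ripDl.
- by move=> c u; rewrite ripZl.
- by move=> m; rewrite mulrC rip_norm_le.
suff zx : z = x by rewrite -zx; exact: (Nz e e0).
apply: injA; apply/eqP; rewrite -subr_eq0 -linearB; apply/eqP/rip_eq0.
rewrite (adjoint_rip AC) ripC ripDr ripNr hz ?subrr //.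
by apply: im; exists (z - x).
Qed.

(** The bounded inverse theorem. If [x] were [adjoint A w] with [w] in the range,
    then [normR x ^+ 2 = rip (A x) w <= normR (A x) * (B * normR x)]; vectors of
    this form approximate every [x]. *)
Lemma bounded_below : exists2 B : R, 0 <= B & forall x, normR x <= B * normR (A x).
Proof.
have [B B0 hB] := adjoint_below; exists B => // x.
have [x0|x0] := eqVneq (normR x) 0; first by rewrite x0 mulr_ge0.
have x1 : 0 < normR x by rewrite lt_def x0 normR_ge0.
rewrite -(ler_pM2l x1); apply: ler_epsilon => e e0.
pose D := B * normR (A x) + normR x.
have D0 : 0 < D by rewrite ltr_wpDl // mulr_ge0.
have [w Mw] := adjoint_dense x (divr_gt0 e0 D0).
rewrite ltr_pdivlMr // => hw.
have h1 : normR x ^+ 2 <= rip (A x) w + normR x * normR (x - adjoint A w).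
  rewrite (adjoint_rip AC); have := rip_le x (x - adjoint A w).
  by rewrite ripDr ripNr rip_normR; lra.
have h2 := rip_le (A x) w.
have h3 : normR (A x) * normR w <= normR (A x) * (B * normR (adjoint A w)).
  by apply: ler_wpM2l (hB _ Mw); exact: normR_ge0.
have h4 : normR (adjoint A w) <= normR x + normR (x - adjoint A w).
  have := normRD x (adjoint A w - x); rewrite addrC subrK (normRB _ x); lra.
have h5 : normR (A x) * (B * normR (adjoint A w)) <=
    normR (A x) * B * (normR x + normR (x - adjoint A w)).
  by rewrite mulrA; apply: ler_wpM2l => //; rewrite mulr_ge0.
rewrite /D in hw; nra.
Qed.

End BoundedBelow.

(** * A mean value inequality with a scalar majorant *)

Section RealDerivative.
Context {R : realType}.
Implicit Types (D : set R) (f : R -> R) (x l : R).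

(** Differentiability relative to [D] in terms of increments, the form shared by
    the one-sided derivative of the majorant and the differentials of [F]. *)
Definition increment_bound D f x l := forall e : R, 0 < e ->
  exists2 d : R, 0 < d & forall u, D u -> `|u - x| < d ->
    `|f u - f x - l * (u - x)| <= e * `|u - x|.

Lemma is_derive_withinP D f x l :
  is_derive_within D f x l <-> increment_bound D f x l.
Proof.
split=> [h e e0|h].
  move/cvgrPdist_lt : h => /(_ e e0).
  rewrite near_withinE near_withinE => /nbhs_ballP[d /= d0 hd]; exists d => // u Du ux.
  have [->|ux0] := eqVneq u x; first by rewrite !subrr mulr0 subrr normr0 mulr0.
  have := hd u; rewrite -ball_normE /= distrC ux => /(_ isT ux0 Du) /ltW.
  rewrite -subr_eq0 in ux0; have ux1 : 0 < `|u - x| by rewrite normr_gt0.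
  rewrite -(ler_pM2r ux1) -normrM mulrBl divfK // distrC.
  by [].
apply/cvgrPdist_le => e e0; have [d d0 hd] := h e e0.
rewrite near_withinE near_withinE; apply/nbhs_ballP; exists d => //= u.
rewrite -ball_normE /= distrC => ux ux0 Du; have := hd u Du ux.
rewrite -subr_eq0 in ux0; have ux1 : 0 < `|u - x| by rewrite normr_gt0.
move=> hu; rewrite -(ler_pM2r ux1) -normrM mulrBl divfK // distrC.
by [].
Qed.

Lemma increment_bound_is_derive D f x l :
  nbhs x D -> increment_bound D f x l -> is_derive x 1 f l.
Proof.
move=> /nbhs_ballP[r /= r0 rD] h.
have hl : h^-1 *: ((f \o shift x) (h *: 1) - f x) @[h --> (0 : R)^'] --> l.
  apply/cvgrPdist_le => e e0; have [d d0 hd] := h e e0.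
  rewrite near_withinE; apply/nbhs_ballP; exists (Num.min d r).
    by rewrite /= lt_min d0.
  move=> k; rewrite -ball_normE /= sub0r normrN lt_min => /andP[kd kr] k0.
  have k1 : 0 < `|k| by rewrite normr_gt0.
  have := hd (k + x); rewrite addrK => hk.
  rewrite -(ler_pM2r k1) -normrM mulrBl /= /GRing.scale /= mulr1 mulrAC mulVf // mul1r.
  rewrite distrC; apply: hk => //; apply: rD.
  by rewrite -ball_normE /= opprD addrCA subrr addr0 normrN.
by split; [apply: cvgP hl|apply: cvg_lim hl].
Qed.

Lemma increment_bound_cvg D f x l :
  increment_bound D f x l -> f @ within D (nbhs x) --> f x.
Proof.
move=> h; apply/cvgrPdist_le => e e0; have [d d0 hd] := h 1 ltr01.
rewrite near_withinE; apply/nbhs_ballP.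
have c0 : 0 < `|l| + 1 by rewrite ltr_wpDl.
exists (Num.min d (e / (`|l| + 1))); first by rewrite /= lt_min d0 divr_gt0.
move=> u; rewrite -ball_normE /= distrC lt_min => /andP[ud ue] Du.
have := hd u Du ud; rewrite mul1r => h1.
have : `|f u - f x| <= `|f u - f x - l * (u - x)| + `|l * (u - x)|.
  by rewrite -[X in `|X| <= _](subrK (l * (u - x))) ler_normD.
rewrite normrM ltr_pdivlMr // in ue *.
rewrite (distrC (f x)); move: h1 ue.
by move: (`|f u - f x|) (`|_ - _ - _|) (`|u - x|) (`|l|) => p q r m h1 h2 h3; lra.
Qed.

Lemma mean_value f (f' : R -> R) (a b : R) : a < b ->
  (forall x : R, a < x < b -> is_derive x 1 f (f' x)) ->
  {within `[a, b], continuous f} ->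
  exists2 c : R, a < c < b & f b - f a = f' c * (b - a).
Proof.
move=> ab df cf; have df' x : x \in `]a, b[ -> is_derive x 1 f (f' x).
  by rewrite in_itv; exact: df.
by have [c cab e] := MVT ab df' cf; exists c.
Qed.

End RealDerivative.

Lemma differentiable_increment (R : realType) (s : scalar_kind)
    (X Y : normedModType (scalars R s)) (F : X -> Y) (z : X) :
  differentiable F z -> forall e : R, 0 < e ->
  exists2 d : R, 0 < d & forall h, normR h < d ->
    normR (F (z + h) - F z - 'd F z h) <= e * normR h.
Proof.
move=> /diff_locally /eqaddoP dF e e0.
have /dF : 0 < scalar_of_real s e.
  by rewrite -[ltLHS](@scalar_of_real0 R s) scalar_of_real_lt.
rewrite /= => /nbhs_BallP[d d0 hd]; exists d => // h hd'.
have := hd h; rewrite /Ball /= subr0 => /(_ hd').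
rewrite !norm_normR -scalar_of_realM scalar_of_real_le.
by rewrite /= !fctE /= opprD addrA (addrC h).
Qed.

Lemma opnormB (R : realType) (s : scalar_kind) (X Y : normedModType (scalars R s))
  (A B : X -> Y) : opnorm (A \- B) = opnorm (B \- A).
Proof.
rewrite /opnorm; congr sup; apply/seteqP.
by split=> _ [x x1 <-]; exists x => //=; rewrite normRB.
Qed.

Lemma real_homogeneousB (R : realType) (s : scalar_kind)
    (X Y : normedModType (scalars R s)) (A B : {linear X -> Y}) :
  real_homogeneous (A \- B).
Proof. by move=> c v /=; rewrite scalerBr; congr (_ - _); exact: linearZ_LR. Qed.

Section MeanValue.
Context {R : realType} {s : scalar_kind} {X Y : hilbertType R s}.
Variables (F : X -> Y) (A : {linear X -> Y}) (C : R) (z e : X) (b t : R).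
Variables psi psi' : R -> R.
Hypotheses (AC : bounded_by C A) (e1 : normR e = 1) (b0 : 0 <= b) (t0 : 0 < t).
Hypothesis dF : forall u : R, 0 <= u <= t -> differentiable F (z + u%:S *: e).
Hypothesis dpsi : forall u : R, 0 < u < t -> is_derive u 1 psi (psi' u).
Hypothesis cpsi : {within `[0, t], continuous psi}.
Hypothesis dF_le : forall u : R, 0 < u < t ->
  b * opnorm ('d F (z + u%:S *: e) \- A) <= psi' u.

Let path_derive w (u : R) : 0 <= u <= t ->
  is_derive u 1 (fun u : R => rip (F (z + u%:S *: e)) w)
    (rip ('d F (z + u%:S *: e) e) w).
Proof.
move=> /dF /differentiable_increment dFu.
apply: (@increment_bound_is_derive _ setT); first exact: filterT.
move=> eps eps0; have w0 : 0 < normR w + 1 by rewrite ltr_wpDl.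
have [d d0 hd] := dFu _ (divr_gt0 eps0 w0); exists d => // v _ vd.
have := hd ((v - u)%:S *: e); rewrite normRZ e1 mulr1 => /(_ vd).
have -> : z + u%:S *: e + (v - u)%:S *: e = z + v%:S *: e.
  by rewrite -addrA -scalerDl -scalar_of_realD (addrC u) subrK.
rewrite linearZ /=; set Dv := 'd F _ e => h.
have -> : rip (F (z + v%:S *: e)) w - rip (F (z + u%:S *: e)) w - rip Dv w * (v - u) =
    rip (F (z + v%:S *: e) - F (z + u%:S *: e) - (v - u)%:S *: Dv) w.
  by rewrite !ripDl !ripNl ripZl (mulrC (v - u)).
apply: (le_trans (rip_norm_le _ _)).
apply: (le_trans (ler_wpM2r (normR_ge0 w) h)).
rewrite mulrAC; apply: ler_wpM2r => //; rewrite mulrAC ler_pdivrMr //.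
by apply: ler_wpM2l; [exact: ltW|rewrite lerDl].
Qed.

(** The mean value inequality. Pairing with a fixed vector reduces it to real
    functions; taking the remainder itself as that vector loses nothing. *)
Lemma remainder_le :
  b * normR (F (z + t%:S *: e) - F z - t%:S *: A e) <= psi t - psi 0.
Proof.
set w := F _ - _ - _.
have opb (u : R) : 0 < u < t -> normR ('d F (z + u%:S *: e) e - A e)
    <= opnorm ('d F (z + u%:S *: e) \- A).
  move=> ut; have utc : 0 <= u <= t by case/andP: ut => /ltW -> /ltW ->.
  have [D D0 hD] := linear_continuous_bounded (diff_continuous (dF utc)).
  have := opnorm_bound (@real_homogeneousB _ _ _ _ _ _) (bounded_byB hD AC) e.
  by rewrite e1 mulr1.
have [w0|w0] := eqVneq (normR w) 0.
  rewrite w0 mulr0; have [c ct ->] := mean_value t0 dpsi cpsi.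
  apply: mulr_ge0; last by rewrite subr0 ltW.
  apply: le_trans (dF_le ct).
  by rewrite mulr_ge0 // opnorm_ge0.
have {}w0 : 0 < normR w by rewrite lt_def w0 normR_ge0.
pose g u := b * (rip (F (z + u%:S *: e)) w - u * rip (A e) w) - normR w * psi u.
pose g' u := b * (rip ('d F (z + u%:S *: e) e) w - rip (A e) w) - normR w * psi' u.
have dg (u : R) : 0 < u < t -> is_derive u 1 g (g' u).
  move=> ut; have utc : 0 <= u <= t by case/andP: ut => /ltW -> /ltW ->.
  have h1 := path_derive w utc; have h2 := dpsi ut.
  have h3 : is_derive u 1 (fun u : R => u * rip (A e) w) (rip (A e) w).
    have h := is_deriveM (is_derive_id u 1) (is_derive_cst (rip (A e) w) u 1).
    by apply: (is_derive_eq h); rewrite /GRing.scale /= mulr0 add0r mulr1.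
  have h4 := is_deriveB (is_deriveZ b (is_deriveB h1 h3)) (is_deriveZ (normR w) h2).
  exact: h4.
have cF : {within `[0, t], continuous (fun u : R => rip (F (z + u%:S *: e)) w)}.
  apply: derivable_within_continuous => u; rewrite in_itv /= => ut.
  by have h := path_derive w ut; exact: (@ex_derive _ _ _ _ _ _ _ h).
have cl : {within `[0, t], continuous (fun u : R => u * rip (A e) w)}.
  apply: derivable_within_continuous => u _.
  by apply: derivableM; [exact: derivable_id|exact: derivable_cst].
have cg : {within `[0, t], continuous g}.
  move=> u; apply: cvgB; last by apply: cvgM; [exact: cvg_cst|exact: cpsi].
  apply: cvgM; first exact: cvg_cst.
  by apply: cvgB; [exact: cF|exact: cl].
have [c ct gc] := mean_value t0 dg cg.
have g'c : g' c <= 0.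
  rewrite /g' -ripNl -ripDl subr_le0.
  apply: (@le_trans _ _ (b * opnorm ('d F (z + c%:S *: e) \- A) * normR w)).
    rewrite -mulrA; apply: ler_wpM2l => //; apply: (le_trans (rip_le _ _)).
    by apply: ler_wpM2r => //; exact: opb.
  by rewrite mulrC; apply: ler_wpM2l => //; exact: dF_le.
have : g t - g 0 <= 0 by rewrite gc pmulr_lle0 // subr0.
have -> : g t - g 0 = normR w * (b * normR w - (psi t - psi 0)).
  have e2 := rip_normR w; rewrite {1}/w !ripDl !ripNl ripZl in e2.
  rewrite /g scalar_of_real0 scale0r addr0.
  transitivity (b * (normR w ^+ 2) - normR w * (psi t - psi 0)); last by ring.
  by rewrite -e2; ring.
by rewrite pmulr_rle0 // subr_le0.
Qed.

End MeanValue.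

(** * The scalar majorant and its Newton iteration *)

Section ScalarMajorant.
Context {R : realType}.
Variables (a : R) (f f' : R -> R).
Hypotheses (a0 : 0 < a) (fC1 : is_C1_ico a f f') (f0 : f 0 = 0) (f'0 : f' 0 = -1).
Hypothesis f'_incr : {in `[0, a[ &, {homo f' : t u / t < u}}.

Let nu := nu_of a f'.
Let rho := rho_of a f f'.

(** The opposite of the Newton iterate of [f] at [t]; convexity makes it positive
    on (0, nu). *)
Definition newton_defect (t : R) := f t / f' t - t.
Local Notation n := newton_defect.

Lemma majorant_deriv_lt (t u : R) : 0 <= t -> t < u -> u < a -> f' t < f' u.
Proof.
move=> t0 tu ua; apply: f'_incr; rewrite ?in_itv //=.
  by rewrite t0 (lt_trans tu).
by rewrite ua (le_trans t0) // ltW.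
Qed.

Lemma majorant_increment (t : R) : 0 <= t < a -> increment_bound `[0, a[ f t (f' t).
Proof. by move=> ta; apply/is_derive_withinP; case: fC1 => + _; apply; rewrite in_itv. Qed.

Lemma nbhs_ico (t : R) : 0 < t < a -> nbhs t `[0, a[%classic.
Proof.
move=> /andP[t0 ta]; have : nbhs t `]0, a[%classic.
  by apply: near_in_itvoo; rewrite in_itv /= t0.
by apply: filterS; apply: subset_itvr; rewrite bnd_simp.
Qed.

Lemma majorant_derive (t : R) : 0 < t < a -> is_derive t 1 f (f' t).
Proof.
move=> ta; apply: (@increment_bound_is_derive _ `[0, a[); first exact: nbhs_ico.
by apply: majorant_increment; case/andP: ta => /ltW -> ->.
Qed.

Lemma majorant_continuous (t u : R) : 0 <= t -> u < a -> {within `[t, u], continuous f}.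
Proof.
move=> t0 ua; apply: (@continuous_subspaceW _ _ _ `[0, a[).
  by apply: subset_itv; rewrite bnd_simp.
apply/subspace_continuousP => x; rewrite /= in_itv => xa.
by apply: increment_bound_cvg; exact: majorant_increment.
Qed.

Lemma majorant_mvt (t u : R) : 0 <= t -> t < u -> u < a ->
  exists2 c : R, t < c < u & f u - f t = f' c * (u - t).
Proof.
move=> t0 tu ua; apply: mean_value => //; last exact: majorant_continuous.
move=> x /andP[tx xu]; apply: majorant_derive.
by rewrite (le_lt_trans t0 tx) (lt_trans xu).
Qed.

(** [f t / t] is a value of [f'] before [t]. *)
Lemma majorant_lt_tangent (t : R) : 0 < t < a -> f t < t * f' t.
Proof.
case/andP=> t0 ta; have [c /andP[c0 ct] h] := majorant_mvt (lexx 0) t0 ta.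
rewrite f0 !subr0 in h; rewrite h mulrC ltr_pM2l //.
by apply: majorant_deriv_lt => //; exact: ltW.
Qed.

(** If [f u >= 0], then [f'] takes a nonnegative value before [u], so that [f]
    increases from [u] on. *)
Lemma majorant_lt0_initial (u t : R) : 0 < u < t -> t < a -> f t < 0 -> f u < 0.
Proof.
move=> /andP[u0 ut] ta ft; rewrite ltNge; apply/negP => fu.
have ua := lt_trans ut ta.
have [c /andP[c0 cu] hc] := majorant_mvt (lexx 0) u0 ua.
have [d /andP[du dt] hd] := majorant_mvt (ltW u0) ut ta.
have cd : f' c < f' d.
  by apply: majorant_deriv_lt; [exact: ltW|exact: lt_trans du|exact: lt_trans ta].
rewrite f0 !subr0 in hc; rewrite hc in fu; rewrite pmulr_lge0 // in fu.
have : 0 <= f' d * (t - u) by rewrite mulr_ge0 ?subr_ge0 ?ltW // (le_lt_trans fu).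
by rewrite -hd hc subr_ge0 => h; have := mulr_ge0 fu (ltW u0); lra.
Qed.

Let nu_has_sup : has_sup [set t | 0 <= t < a /\ f' t < 0].
Proof.
split; first by exists 0; rewrite /= lexx a0 f'0; split => //; rewrite ltrN10.
by exists a => t [/andP[_ /ltW]].
Qed.

Lemma nu_ltP (t : R) : 0 <= t -> t < nu -> t < a /\ f' t < 0.
Proof.
move=> t0 /(sup_gt (proj1 nu_has_sup))[u [/andP[u0 ua] u1] tu].
split; first exact: lt_trans ua.
by apply: lt_trans u1; exact: majorant_deriv_lt.
Qed.

(** The set whose supremum is [rho] is nonempty because [t < rho] is positive. *)
Lemma rho_ltP (t : R) : 0 < t -> t < rho -> t < nu /\ n t < t.
Proof.
move=> t0 tr.
pose S := [set d | 0 < d < nu_of a f' /\ forall t, 0 < t < d -> (f t / f' t - t) / t < 1].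
have S0 : S !=set0.
  apply/set0P; apply/eqP => h; move: tr; rewrite /rho /rho_of -/S h sup0.
  by move=> /(lt_trans t0); rewrite ltxx.
have [d [/andP[d0 dnu] hd] td] := sup_gt S0 tr.
split; first exact: lt_trans dnu.
by have := hd t; rewrite t0 td => /(_ isT); rewrite ltr_pdivrMr // mul1r.
Qed.

Lemma newton_defect_gt0 (t : R) : 0 < t -> t < nu -> 0 < n t.
Proof.
move=> t0 tnu; have [ta f't] := nu_ltP (ltW t0) tnu.
have h := @majorant_lt_tangent t; rewrite t0 ta in h; have {}h := h isT.
rewrite /n subr_gt0 ltr_ndivlMr //.
Qed.

Lemma newton_defect0 : n 0 = 0.
Proof. by rewrite /n f0 mul0r subrr. Qed.

Lemma newton_defect_step (t : R) : 0 < t -> t < nu -> `|t - f t / f' t| = n t.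
Proof.
by move=> t0 tnu; rewrite distrC gtr0_norm //; exact: newton_defect_gt0.
Qed.

Lemma newton_defect_continuous (t : R) : 0 < t -> t < nu -> n @ t --> n t.
Proof.
move=> t0 tnu; have [ta f't] := nu_ltP (ltW t0) tnu.
have ta' : 0 < t < a by rewrite t0.
have cf : f @ t --> f t.
  have := increment_bound_cvg (@majorant_increment t _); rewrite (ltW t0) ta => /(_ isT).
  by rewrite within_interior //; exact: nbhs_ico.
have cf' : f' @ t --> f' t.
  case: fC1 => _ /subspace_continuousP/(_ t); rewrite /= in_itv /= (ltW t0) ta.
  move=> /(_ isT); rewrite within_interior //; exact: nbhs_ico.
apply: cvgB; last exact: cvg_id.
by apply: cvgM => //; apply: cvgV => //; rewrite lt_eqF.
Qed.

(** Both [f t / t] and [f' t] tend to -1 at 0. *)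
Lemma newton_defect_small (e : R) : 0 < e ->
  exists2 d : R, 0 < d & forall t : R, 0 < t -> t < d -> t < nu -> n t / t < e.
Proof.
move=> e0.
(* With [f t >= - (1 + q) * t] and [f' t <= q - 1], the claim reduces to
   [2 * q + e * q < e]. *)
pose q := Num.min (e / 8) (1 / 2).
have q0 : 0 < q by rewrite lt_min !divr_gt0.
have [d1 d10 h1] : exists2 d : R, 0 < d & forall u : R, u \in `[0, a[ -> `|u - 0| < d ->
    `|f u - f 0 - f' 0 * (u - 0)| <= q * `|u - 0|.
  have [|d d0 hd] := @majorant_increment 0 _ _ q0; first by rewrite lexx.
  by exists d => // u; exact: hd.
have [d2 d20 h2] : exists2 d : R, 0 < d & forall u : R, 0 <= u < a -> u < d -> `|f' u + 1| <= q.
  case: fC1 => _ /subspace_continuousP/(_ 0); rewrite /= in_itv /= lexx a0 => /(_ isT).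
  move=> /cvgrPdist_le/(_ q q0); rewrite near_withinE => /nbhs_ballP[d /= d0 hd].
  exists d => // u /andP[u0 ua] ud; have : `|f' 0 - f' u| <= q.
    apply: hd; last by rewrite in_itv /= u0.
    by rewrite -ball_normE /= sub0r normrN ger0_norm.
  by rewrite f'0 -opprD normrN addrC.
exists (Num.min d1 d2); first by rewrite lt_min d10.
move=> t t0; rewrite lt_min => /andP[td1 td2] tnu.
have [ta f't] := nu_ltP (ltW t0) tnu.
have := h1 t; rewrite in_itv /= (ltW t0) ta subr0 f0 f'0 gtr0_norm // subr0 mulN1r opprK.
move=> /(_ isT td1) k1; have := h2 t; rewrite (ltW t0) ta => /(_ isT td2) k2.
rewrite ltr_pdivrMr // /n ltrBlDr ltr_ndivrMr //.
have [qe qh] : q <= e / 8 /\ q <= 1 / 2 by split; rewrite ge_min lexx ?orbT.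
move/ler_normlP : k1 => [k1 k1']; move/ler_normlP : k2 => [k2 k2'].
have h3 : (e * t + t) * f' t <= (e * t + t) * (q - 1).
  by apply: ler_wpM2l; [rewrite addr_ge0 ?mulr_ge0 ?ltW|lra].
have h4 : e * q <= e * (1 / 2) by rewrite ler_pM2l.
have h5 : 0 < t * (e - e * q - 2 * q) by rewrite mulr_gt0 //; lra.
lra.
Qed.

Section Contraction.
Variable u : nat -> R.
Hypotheses (u_ge0 : forall k, 0 <= u k) (u_lt : u 0%N < rho).
Hypothesis u_step : forall k, u k < rho -> u k.+1 <= n (u k).

Lemma contraction_lt k : u k < rho.
Proof.
elim: k => // k IH; have := u_step IH.
have [uk0|uk0] := eqVneq (u k) 0.
  by rewrite uk0 newton_defect0 => h; apply: (le_lt_trans h); rewrite -uk0.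
have uk1 : 0 < u k by rewrite lt_def uk0 u_ge0.
have [_ h] := rho_ltP uk1 IH => h'.
by apply: (le_lt_trans h'); exact: lt_trans IH.
Qed.

Lemma contraction_noninc k : u k.+1 <= u k.
Proof.
have := u_step (contraction_lt k).
have [->|uk0] := eqVneq (u k) 0; first by rewrite newton_defect0.
have uk1 : 0 < u k by rewrite lt_def uk0 u_ge0.
have [_ h] := rho_ltP uk1 (contraction_lt k) => h'.
by apply: (le_trans h'); exact: ltW.
Qed.

(** The limit [L] of [u] satisfies [L <= n L], which [n t < t] excludes unless
    [L] is 0. *)
Lemma contraction_cvg0 : u k @[k --> \oo] --> (0 : R).
Proof.
have ninc : nonincreasing_seq u by apply/nonincreasing_seqP; exact: contraction_noninc.
have cu : cvgn u.
  by apply: nonincreasing_is_cvgn ninc _; exists 0 => _ [k _ <-].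
have Lle := nonincreasing_cvgn_ge ninc cu; set L := limn u in Lle.
have uL : u @ \oo --> L by [].
have L0 : 0 <= L by apply: limr_ge => //; exact: nearW.
have [<-//|Ln0] := eqVneq L 0.
have {Ln0}L1 : 0 < L by rewrite lt_def Ln0.
have [Lnu nL] := rho_ltP L1 (le_lt_trans (Lle 0%N) u_lt).
have := newton_defect_continuous L1 Lnu.
move=> /cvgrPdist_lt/(_ (L - n L)); rewrite subr_gt0 => /(_ nL) cn.
have [N _ hN] := uL _ cn; have := hN N (leqnn N); rewrite /= => /ltr_normlP[+ _].
rewrite opprB => h; have := u_step (contraction_lt N); have := Lle N.+1.
move: h; lra.
Qed.

Lemma contraction_superlinear : u k.+1 / u k @[k --> \oo] --> (0 : R).
Proof.
apply/cvgrPdist_lt => e e0; have [d d0 hd] := newton_defect_small e0.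
have /cvgrPdist_lt/(_ d d0)[N _ hN] := contraction_cvg0.
exists N => // k /hN; rewrite /= !sub0r !normrN ger0_norm // => ukd.
rewrite ger0_norm ?divr_ge0 //.
have [->|uk0] := eqVneq (u k) 0; first by rewrite invr0 mulr0.
have uk1 : 0 < u k by rewrite lt_def uk0 u_ge0.
have [unu _] := rho_ltP uk1 (contraction_lt k).
apply: le_lt_trans (hd _ uk1 ukd unu).
by rewrite ler_pM2r ?invr_gt0 //; exact: u_step (contraction_lt k).
Qed.

End Contraction.

End ScalarMajorant.

(** * One Gauss-Newton step *)

Section GaussNewtonStep.
Context {R : realType} {s : scalar_kind} {X Y : hilbertType R s}.
Variables (Omega : set X) (F : X -> Y) (xs : X) (a : R) (f f' : R -> R).
Hypothesis hyp : majorant_setting Omega F xs a f f'.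

Let a0 := ms_radius_gt0 hyp.
Let fC1 := ms_majorant_C1 hyp.
Let f0 := proj1 (ms_h1 hyp).
Let f'0 := proj2 (ms_h1 hyp).
Let f'_incr := ms_h2 hyp.
Let kappa := kappa_of Omega xs a.
Let nu := nu_of a f'.
Let beta := opnorm (mp_inverse ('d F xs)).

Let kappa_has_sup : has_sup [set t | 0 <= t < a /\ Ball xs t `<=` Omega].
Proof.
split; last by exists a => t [/andP[_ /ltW]].
exists 0; split; first by rewrite lexx a0.
by move=> x; rewrite /Ball /= ltNge normR_ge0.
Qed.

Lemma kappa_leP (t : R) : t < kappa -> t < a /\ Ball xs t `<=` Omega.
Proof.
move=> /(sup_gt (proj1 kappa_has_sup))[u [/andP[_ ua] uO] tu].
split; first exact: lt_trans ua.
by move=> x xt; apply: uO; exact: lt_trans tu.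
Qed.

Lemma Ball_kappa : Ball xs kappa `<=` Omega.
Proof.
move=> x /(sup_gt (proj1 kappa_has_sup))[u [_ uO] xu]; exact: uO.
Qed.

Lemma kappa_le : kappa <= a.
Proof.
apply: ge_sup; first exact: (proj1 kappa_has_sup).
by move=> t [/andP[_ /ltW]].
Qed.

Lemma diff_bounded x : Omega x -> exists C, bounded_by C ('d F x).
Proof.
move=> Ox; have [dF _] := ms_C1 hyp Ox.
by have [C _ hC] := linear_continuous_bounded (diff_continuous dF); exists C.
Qed.

Lemma diff_opnorm x y v : Omega x -> Omega y ->
  normR ('d F x v - 'd F y v) <= opnorm ('d F x \- 'd F y) * normR v.
Proof.
move=> /diff_bounded[C hC] /diff_bounded[D hD].
exact: (opnorm_bound (@real_homogeneousB _ _ _ _ _ _) (bounded_byB hC hD)).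
Qed.

Let beta_ge0 : 0 <= beta. Proof. exact: opnorm_ge0. Qed.

(** The bounded inverse theorem enters here: without it [beta] would be the
    supremum of a possibly unbounded set. *)
Lemma diff_below v : normR v <= beta * normR ('d F xs v).
Proof.
have [C hC] := diff_bounded (ms_mem hyp).
have clA := ms_closed_image hyp (ms_mem hyp).
have [B B0 hB] := bounded_below hC (ms_injective hyp) clA.
have hb := mp_inverse_bounded hC (ms_injective hyp) clA B0 hB.
have := opnorm_bound (mp_inverse_homogeneous hC (ms_injective hyp) clA) hb ('d F xs v).
by rewrite (mp_inverseK hC (ms_injective hyp)).
Qed.

Lemma majorant_at_center x : Ball xs kappa x ->
  beta * opnorm ('d F x \- 'd F xs) <= f' (normR (x - xs)) + 1.
Proof.
move=> xk; have := @ms_majorant _ _ _ _ _ _ _ _ _ _ hyp 0 x.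
by rewrite lexx ler01 scalar_of_real0 scale0r addr0 mul0r f'0 opprK => /(_ isT xk).
Qed.

Section Step.
Variable x : X.
Let t := normR (x - xs).
Hypotheses (xk : t < kappa) (xn : t < nu).

Let Ox : Omega x. Proof. exact: Ball_kappa. Qed.
Let f't : f' t < 0. Proof. by have [] := nu_ltP a0 f'0 f'_incr (normR_ge0 _) xn. Qed.

(** The lower bound at the center survives a perturbation of relative size
    [f' t + 1 < 1]; it yields both the injectivity of [F'(x)] and the norm of its
    Moore-Penrose inverse. *)
Lemma diff_below_near v : normR v <= beta / (- f' t) * normR ('d F x v).
Proof.
have ft0 : 0 < - f' t by rewrite oppr_gt0.
rewrite mulrAC ler_pdivlMr //.
have h1 := diff_below v.
have h2 := normRD ('d F x v) ('d F xs v - 'd F x v); rewrite addrC subrK normRB in h2.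
have h3 := diff_opnorm v Ox (ms_mem hyp).
have h4 : beta * normR ('d F x v - 'd F xs v) <= (f' t + 1) * normR v.
  apply: (le_trans (ler_wpM2l beta_ge0 h3)); rewrite mulrA.
  by apply: ler_wpM2r; [exact: normR_ge0|exact: majorant_at_center].
have h5 := ler_wpM2l beta_ge0 h2.
lra.
Qed.

Lemma diff_injective_near : injective ('d F x).
Proof.
move=> u v uv; apply/eqP; rewrite -subr_eq0; apply/eqP/normR_eq0/eqP.
rewrite eq_le normR_ge0 andbT; apply: (le_trans (diff_below_near _)).
by rewrite linearB uv subrr normR0 mulr0.
Qed.

(** At distance [u] from [xs] on the segment to [x], the majorant condition bounds
    the variation of [F'] by [f' t - f' u], the derivative of [f' t * u - f u]. *)
Lemma linearization_remainder_le :
  beta * normR ('d F x (x - xs) - F x) <= t * f' t - f t.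
Proof.
have [t0|tn0] := eqVneq t 0.
  have -> : x = xs by apply/eqP; rewrite -subr_eq0; apply/eqP/normR_eq0.
  by rewrite (ms_zero hyp) subrr linear0 subrr normR0 t0 f0 mulr0 mul0r subrr.
have t0 : 0 < t by rewrite lt_def tn0 normR_ge0.
have [ta _] := kappa_leP xk.
have [C hC] := diff_bounded Ox.
pose e := (t^-1)%:S *: (x - xs).
have et : t%:S *: e = x - xs.
  by rewrite scalerA -scalar_of_realM mulfV // scalar_of_real1 scale1r.
have e1 : normR e = 1 by rewrite normRZ gtr0_norm ?invr_gt0 // mulVf.
have ue (u : R) : xs + (u / t)%:S *: (x - xs) = xs + u%:S *: e.
  by rewrite scalerA -scalar_of_realM.
have inO (u : R) : 0 <= u <= t -> Omega (xs + u%:S *: e).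
  move=> /andP[u0 ut]; apply: Ball_kappa; rewrite /Ball /= addrAC subrr add0r.
  by rewrite normRZ e1 mulr1 ger0_norm // (le_lt_trans ut).
have := @remainder_le _ _ _ _ F ('d F x) C xs e beta t (fun u => f' t * u - f u)
  (fun u => f' t - f' u) hC e1 beta_ge0 t0.
have -> : xs + t%:S *: e = x by rewrite et addrC subrK.
have -> : t%:S *: 'd F x e = 'd F x (x - xs) by rewrite -[in RHS]et; symmetry; exact: linearZ_LR.
rewrite (ms_zero hyp) f0 mulr0 !subr0 => h.
rewrite normRB (mulrC t); apply: h => [u|u /andP[u0 ut]||u /andP[u0 ut]].
- by move=> /inO Ou; have [] := ms_C1 hyp Ou.
- have h : is_derive u 1 f (f' u).
    by apply: (majorant_derive fC1); rewrite u0 (lt_trans ut).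
  have h' := is_deriveB (is_deriveZ (f' t) (is_derive_id u 1)) h.
  by apply: (is_derive_eq h'); rewrite /GRing.scale /= mulr1.
- move=> u; apply: cvgB; last exact: (majorant_continuous fC1 (lexx 0) ta).
  apply: cvgM; first exact: cvg_cst.
  by move: u; apply: continuous_subspaceT => u; exact: cvg_id.
- have ut1 : 0 <= u / t <= 1.
    apply/andP; split; first by apply: divr_ge0; exact: ltW.
    by rewrite ler_pdivrMr // mul1r ltW.
  have := ms_majorant hyp ut1 xk; rewrite ue -/t divfK // opnormB.
  by [].
Qed.

(** The new error is the Moore-Penrose inverse of the linearisation remainder;
    the bounds on the two factors multiply to the Newton defect of [f]. *)
Lemma gauss_newton_step_le :
  normR (x - mp_inverse ('d F x) (F x) - xs) <= newton_defect f f' t.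
Proof.
have [C hC] := diff_bounded Ox.
have clA := ms_closed_image hyp Ox.
have ft0 : 0 < - f' t by rewrite oppr_gt0.
rewrite addrAC -(mp_inverse_subl hC diff_injective_near clA).
have c0 : 0 <= beta / (- f' t) by rewrite divr_ge0 // ltW.
apply: (le_trans (mp_inverse_bounded hC diff_injective_near clA c0 diff_below_near _)).
rewrite mulrAC ler_pdivrMr //; apply: (le_trans linearization_remainder_le).
rewrite /newton_defect mulrN mulrBl divfK ?lt_eqF //; lra.
Qed.

End Step.

(** At a second zero [x], the remainder of the linearisation at [xs] is
    [- F'(xs) (x - xs)], so that [t <= f t + t]; but [f] is negative up to [sigma]. *)
Lemma zero_unique x : Ball xs (sigma_of kappa f) x -> F x = 0 -> x = xs.
Proof.
move=> xsig Fx; apply: contrapT => xxs; pose t := normR (x - xs).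
have t0 : 0 < t.
  by rewrite normR_gt0 // subr_eq0; apply/eqP.
have S0 : [set t | 0 < t < kappa /\ f t < 0] !=set0.
  apply/set0P; apply/eqP => h; move: xsig; rewrite /Ball /= /sigma_of h sup0.
  by rewrite ltNge normR_ge0.
have [d [/andP[d0 dk] fd] td] := sup_gt S0 xsig.
have [da _] := kappa_leP dk.
have xk : t < kappa by apply: lt_trans dk.
have [ta _] := kappa_leP xk.
have ft : f t < 0.
  by apply: (majorant_lt0_initial fC1 f0 f'_incr _ da fd); rewrite t0.
have [C hC] := diff_bounded (ms_mem hyp).
pose e := (t^-1)%:S *: (x - xs).
have et : t%:S *: e = x - xs.
  by rewrite scalerA -scalar_of_realM mulfV ?gt_eqF // scalar_of_real1 scale1r.
have e1 : normR e = 1 by rewrite normRZ gtr0_norm ?invr_gt0 // mulVf // gt_eqF.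
have inB (u : R) : 0 <= u <= t -> Ball xs kappa (xs + u%:S *: e).
  move=> /andP[u0 ut]; rewrite /Ball /= addrAC subrr add0r.
  by rewrite normRZ e1 mulr1 ger0_norm // (le_lt_trans ut).
have := @remainder_le _ _ _ _ F ('d F xs) C xs e beta t (fun u => f u + u)
  (fun u => f' u + 1) hC e1 beta_ge0 t0.
have -> : xs + t%:S *: e = x by rewrite et addrC subrK.
have -> : t%:S *: 'd F xs e = 'd F xs (x - xs) by rewrite -[in RHS]et; symmetry; exact: linearZ_LR.
rewrite Fx (ms_zero hyp) subr0 add0r normRN f0 add0r subr0 => h.
suff : t <= f t + t by lra.
apply: (le_trans (diff_below _)); apply: h => [u|u /andP[u0 ut]||u /andP[u0 ut]].
- by move=> /inB/Ball_kappa Ou; have [] := ms_C1 hyp Ou.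
- have h : is_derive u 1 f (f' u).
    by apply: (majorant_derive fC1); rewrite u0 (lt_trans ut).
  exact: is_deriveD h (is_derive_id u 1).
- move=> u; apply: cvgD; first exact: (majorant_continuous fC1 (lexx 0) ta).
  by move: u; apply: continuous_subspaceT => u; exact: cvg_id.
- have ut1 : 0 <= u <= t by rewrite !ltW.
  apply: (le_trans (majorant_at_center (inB u ut1))).
  by rewrite addrAC subrr add0r normRZ e1 mulr1 gtr0_norm.
Qed.

End GaussNewtonStep.

(** * Convergence and rates *)

Section PowerRate.
Context {R : realType}.
Variables (p : R) (d t : nat -> R).
Hypotheses (p0 : 0 <= p) (d_ge0 : forall k, 0 <= d k) (t_gt0 : forall k, 0 < t k).
Hypothesis d0 : d 0%N = t 0%N.
Hypothesis d_step : forall k, d k <= t k ->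
  d k.+1 <= t k.+1 / t k `^ (p + 1) * d k `^ (p + 1).

(** Since [p + 1 >= 0], the bound at [d k <= t k] is at most its value [t k.+1] at
    [d k = t k]. *)
Lemma dominated_le k : d k <= t k.
Proof.
elim: k => [|k IH]; first by rewrite d0.
apply: (le_trans (d_step IH)).
rewrite mulrAC ler_pdivrMr ?powR_gt0 // ler_pM2l //.
by apply: ge0_ler_powR => //; rewrite ?nnegrE ?addr_ge0 // ltW.
Qed.

Hypothesis d_step0 : forall k,
  d k.+1 <= t 1%N / t 0%N `^ (p + 1) * d k `^ (p + 1).

Lemma linear_rate k : p = 0 -> d k <= t 0%N * (t 1%N / t 0%N) ^+ k.
Proof.
move=> pE; elim: k => [|k IH]; first by rewrite mulr1 d0.
have t0 := ltW (t_gt0 0).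
apply: (le_trans (d_step0 k)); rewrite pE add0r !powRr1 //.
by rewrite exprS mulrCA ler_pM2l // divr_gt0.
Qed.

Lemma power_rate k : p != 0 ->
  d k <= t 0%N * (t 1%N / t 0%N) `^ (((p + 1) ^+ k - 1) / p).
Proof.
move=> pn0; elim: k => [|k IH]; first by rewrite subrr mul0r powRr0 mulr1 d0.
have Q0 : 0 < t 1%N / t 0%N by rewrite divr_gt0.
apply: (le_trans (d_step0 k)).
(* The exponents satisfy [E k.+1 = 1 + E k * (p + 1)]. *)
set Q := _ / t 0%N in Q0 IH *; set E := (_ - 1) / p in IH.
have -> : ((p + 1) ^+ k.+1 - 1) / p = 1 + E * (p + 1).
  by rewrite /E exprSr; field.
have h : d k `^ (p + 1) <= (t 0%N * Q `^ E) `^ (p + 1).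
  apply: ge0_ler_powR => //; rewrite ?addr_ge0 ?nnegrE //.
  by rewrite mulr_ge0 ?powR_ge0 // ltW.
have c0 : 0 <= t 1%N / t 0%N `^ (p + 1) by rewrite divr_ge0 ?powR_ge0 // ltW.
apply: (le_trans (ler_wpM2l c0 h)).
have t0 := ltW (t_gt0 0).
have -> : Q `^ (1 + E * (p + 1)) = Q * Q `^ (E * (p + 1)).
  have Qn : (1 + E * (p + 1) == 0) ==> (Q != 0) by rewrite (gt_eqF Q0) implybT.
  by rewrite (powRD Qn) powRr1 // ltW.
rewrite powRM ?powR_ge0 // -powRrM mulrA divfK; last by rewrite gt_eqF ?powR_gt0.
by rewrite mulrA (mulrC (t 0%N)) /Q divfK // gt_eqF.
Qed.

End PowerRate.

Section Convergence.
Context {R : realType} {s : scalar_kind} {X Y : hilbertType R s}.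
Variables (Omega : set X) (F : X -> Y) (xs : X) (a : R) (f f' : R -> R).
Hypothesis hyp : majorant_setting Omega F xs a f f'.

Let a0 := ms_radius_gt0 hyp.
Let fC1 := ms_majorant_C1 hyp.
Let f0 := proj1 (ms_h1 hyp).
Let f'0 := proj2 (ms_h1 hyp).
Let f'_incr := ms_h2 hyp.
Let kappa := kappa_of Omega xs a.
Let nu := nu_of a f'.
Let rho := rho_of a f f'.
Let r := Num.min kappa rho.
Local Notation n := (newton_defect f f').

Variable x0 : X.
Hypotheses (x0r : Ball xs r x0) (x0n : x0 <> xs).

Let t_ := majorant_seq f f' (normR (x0 - xs)).
Let x_ := gauss_newton F x0.
Let d_ k := normR (x_ k - xs).

Let t0_gt0 : 0 < t_ 0%N.
Proof. by rewrite normR_gt0 // subr_eq0; apply/eqP. Qed.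

Let r_kappa t : t < r -> t < kappa. Proof. by rewrite lt_min => /andP[]. Qed.
Let r_rho t : t < r -> t < rho. Proof. by rewrite lt_min => /andP[]. Qed.

Let r_nu t : 0 <= t -> t < r -> t < nu.
Proof.
move=> t0 tr; have [tz|tn0] := eqVneq t 0; last first.
  by have [] := @rho_ltP _ a f f' t _ (r_rho tr); rewrite // lt_def tn0.
have [h _] := rho_ltP t0_gt0 (r_rho x0r); rewrite tz; exact: lt_trans h.
Qed.

Let step_t k : 0 < t_ k < r -> t_ k.+1 = n (t_ k).
Proof.
move=> /andP[t0 tr]; apply: (newton_defect_step a0 fC1 f0 f'0 f'_incr t0).
exact: r_nu (ltW t0) tr.
Qed.

Lemma majorant_seq_itv k : 0 < t_ k < r.
Proof.
elim: k => [|k IH]; first by apply/andP.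
rewrite (step_t IH); case/andP: IH => t0 tr.
rewrite (newton_defect_gt0 a0 fC1 f0 f'0 f'_incr t0 (r_nu (ltW t0) tr)) /=.
by have [_ h] := rho_ltP t0 (r_rho tr); exact: lt_trans tr.
Qed.

Lemma majorant_seqS k : t_ k.+1 = n (t_ k).
Proof. exact: step_t (majorant_seq_itv k). Qed.

Lemma majorant_seq_decr k : t_ k.+1 < t_ k.
Proof.
rewrite majorant_seqS; case/andP: (majorant_seq_itv k) => t0 tr.
by have [] := rho_ltP t0 (r_rho tr).
Qed.

Lemma majorant_seq_is_well_defined : majorant_seq_well_defined a f f' (normR (x0 - xs)).
Proof.
move=> k; case/andP: (majorant_seq_itv k) => t0 tr.
have [ta ft] := nu_ltP a0 f'0 f'_incr (ltW t0) (r_nu (ltW t0) tr).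
by rewrite -/t_ (ltW t0) ta lt_eqF.
Qed.

Lemma gauss_newton_lt k : d_ k < r /\ d_ k.+1 <= n (d_ k).
Proof.
have step : d_ k < r -> d_ k.+1 <= n (d_ k).
  move=> dr; apply: (gauss_newton_step_le hyp); first exact: r_kappa.
  exact: r_nu.
suff dr : d_ k < r by split => //; exact: step.
have step' j : d_ j < r -> d_ j.+1 < r.
  move=> dr; apply: (@le_lt_trans _ _ (d_ j)) => //.
  apply: (le_trans (gauss_newton_step_le hyp (r_kappa dr) (r_nu (normR_ge0 _) dr))).
  have [dz|dn0] := eqVneq (d_ j) 0; first by rewrite -/(d_ j) dz newton_defect0.
  have dj : 0 < d_ j by rewrite lt_def dn0 normR_ge0.
  by have [_ /ltW] := rho_ltP dj (r_rho dr).
by elim: k {step} => [|k IH]; [exact: x0r|exact: step'].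
Qed.

Lemma gauss_newton_is_well_defined : gauss_newton_well_defined Omega F x0.
Proof.
move=> k; have [dr _] := gauss_newton_lt k.
split; first by apply: (Ball_kappa hyp); exact: r_kappa.
by apply: (diff_injective_near hyp (r_kappa dr)); exact: r_nu.
Qed.

Let contr_t k : t_ k < rho -> t_ k.+1 <= n (t_ k).
Proof. by rewrite majorant_seqS. Qed.

Let contr_d k : d_ k < rho -> d_ k.+1 <= n (d_ k).
Proof. by have [] := gauss_newton_lt k. Qed.

Let t_ge0 k : 0 <= t_ k. Proof. by case/andP: (majorant_seq_itv k) => /ltW. Qed.
Let d_ge0 k : 0 <= d_ k. Proof. exact: normR_ge0. Qed.

Lemma majorant_seq_cvg : t_ k @[k --> \oo] --> (0 : R).
Proof. exact: (contraction_cvg0 a0 fC1 f0 f'0 f'_incr t_ge0 (r_rho x0r) contr_t). Qed.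

Lemma majorant_seq_superlinear : t_ k.+1 / t_ k @[k --> \oo] --> (0 : R).
Proof.
exact: (contraction_superlinear a0 fC1 f0 f'0 f'_incr t_ge0 (r_rho x0r) contr_t).
Qed.

Lemma gauss_newton_cvg : x_ k @[k --> \oo] --> xs.
Proof.
apply/cvg_normRP.
exact: (contraction_cvg0 a0 fC1 f0 f'0 f'_incr d_ge0 (r_rho x0r) contr_d).
Qed.

Lemma gauss_newton_superlinear : d_ k.+1 / d_ k @[k --> \oo] --> (0 : R).
Proof.
exact: (contraction_superlinear a0 fC1 f0 f'0 f'_incr d_ge0 (r_rho x0r) contr_d).
Qed.

(** [f] is negative just after 0, and the ball that contains [x0] is not empty. *)
Lemma sigma_gt0 : 0 < sigma_of kappa f.
Proof.
set t := t_ 0%N / 2; have t0 : 0 < t by rewrite divr_gt0.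
have tr : t < r.
  by apply: lt_trans x0r; rewrite /t /t_ /= ltr_pdivrMr // ltr_pMr // ltr1n.
have [ta ft] := nu_ltP a0 f'0 f'_incr (ltW t0) (r_nu (ltW t0) tr).
have ft0 : f t < 0.
  have h := @majorant_lt_tangent _ a f f' fC1 f0 f'_incr t.
  rewrite t0 ta in h; apply: lt_trans (h isT) _; by rewrite pmulr_rlt0.
apply: (lt_le_trans t0); apply: ub_le_sup; last first.
  by split => //; rewrite t0 r_kappa.
by exists kappa => u [/andP[_ /ltW]].
Qed.

Lemma zeros_in_ball : [set x | Ball xs (sigma_of kappa f) x /\ F x = 0] = [set xs].
Proof.
apply/seteqP; split=> [x [xsig Fx]|_ ->]; first exact: (zero_unique hyp xsig Fx).
by rewrite /Ball /= subrr normR0 (ms_zero hyp) sigma_gt0.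
Qed.

Section Rate.
Variable p : R.
Hypothesis p01 : 0 <= p <= 1.
Hypothesis h3 : {in `]0, nu[ &,
  {homo (fun t => (f t / f' t - t) / t `^ (p + 1)) : t u / t < u}}.

Let q t := n t / t `^ (p + 1).

Let q_lt t u : 0 < t -> t < u -> u < r -> q t < q u.
Proof.
move=> t0 tu ur; have u0 := lt_trans t0 tu; have un := r_nu (ltW u0) ur.
by apply: h3 => //; rewrite in_itv /= ?t0 ?u0 ?un // (lt_trans tu).
Qed.

Let q_le t u : 0 < t -> t <= u -> u < r -> q t <= q u.
Proof.
move=> t0; rewrite le_eqVlt => /predU1P[->//|tu] ur; exact/ltW/q_lt.
Qed.

Let t_gt0 k : 0 < t_ k. Proof. by case/andP: (majorant_seq_itv k). Qed.
Let t_lt k : t_ k < r. Proof. by case/andP: (majorant_seq_itv k). Qed.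

Let qE k : t_ k.+1 / t_ k `^ (p + 1) = q (t_ k).
Proof. by rewrite majorant_seqS. Qed.

Lemma rate_decr k : t_ k.+2 / t_ k.+1 `^ (p + 1) < t_ k.+1 / t_ k `^ (p + 1).
Proof. by rewrite !qE; apply: q_lt => //; exact: majorant_seq_decr. Qed.

Let step_le k : d_ k <= t_ k ->
  d_ k.+1 <= t_ k.+1 / t_ k `^ (p + 1) * d_ k `^ (p + 1).
Proof.
move=> dt; have [_ h] := gauss_newton_lt k; apply: (le_trans h).
rewrite qE; have [dz|dn0] := eqVneq (d_ k) 0.
  by rewrite dz newton_defect0 // mulr_ge0 ?powR_ge0 // -qE divr_ge0 ?powR_ge0.
have d0 : 0 < d_ k by rewrite lt_def dn0 normR_ge0.
rewrite -ler_pdivrMr ?powR_gt0 //; exact: q_le.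
Qed.

Let p0 : 0 <= p. Proof. by case/andP: p01. Qed.

Let d_le k : d_ k <= t_ k.
Proof. by apply: (@dominated_le R p d_ t_). Qed.

Let t_le0 k : t_ k <= t_ 0%N.
Proof. by elim: k => // k IH; apply: le_trans IH; exact/ltW/majorant_seq_decr. Qed.

Lemma rate_le k :
  d_ k.+1 <= t_ k.+1 / t_ k `^ (p + 1) * d_ k `^ (p + 1)
    <= t_ 1%N / t_ 0%N `^ (p + 1) * d_ k `^ (p + 1).
Proof.
apply/andP; split; first exact: step_le (d_le k).
by rewrite !qE; apply: ler_wpM2r; [exact: powR_ge0|exact: q_le].
Qed.

Let step_le0 k : d_ k.+1 <= t_ 1%N / t_ 0%N `^ (p + 1) * d_ k `^ (p + 1).
Proof. by case/andP: (rate_le k) => /le_trans h /h. Qed.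

Lemma rate_linear : p = 0 -> forall k, d_ k <= t_ 0%N * (t_ 1%N / t_ 0%N) ^+ k.
Proof. by move=> pE k; apply: (@linear_rate R p d_ t_). Qed.

Lemma rate_power : p <> 0 -> forall k,
  d_ k <= t_ 0%N * (t_ 1%N / t_ 0%N) `^ (((p + 1) ^+ k - 1) / p).
Proof.
by move=> /eqP pn k; apply: (@power_rate R p d_ t_).
Qed.

End Rate.

End Convergence.

(** * Sharpness of the radius on the real line *)

Section RealLine.
Variable R : realType.

(** A name of its own keeps the inner product below off [R] itself. *)
Definition real_line : Type := R^o.
HB.instance Definition _ := CompleteNormedModule.copy real_line R^o.

Definition real_inner (x y : real_line) : scalars R RealScalars := (x : R) * (y : R).

Fact real_inner_bilinear : bilinear_for
  (GRing.Scale.Law.clone _ _ ( *%R ) _)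
  (GRing.Scale.Law.clone _ _ (@scalar_conj R RealScalars \; *%R) _)
  (real_inner : real_line -> real_line -> scalars R RealScalars).
Proof.
split=> [u'|u] c x y; first by rewrite /real_inner /= mulrDl mulrA.
by rewrite /real_inner /= mulrDr mulrCA.
Qed.

HB.instance Definition _ := @bilinear_isBilinear.Build (scalars R RealScalars)
  real_line real_line (scalars R RealScalars) _ _ real_inner real_inner_bilinear.

Fact real_inner_sym (x y : real_line) :
  real_inner x y = (-1) ^+ false * @scalar_conj R RealScalars (real_inner y x).
Proof. by rewrite expr0 mul1r /real_inner /= mulrC. Qed.

HB.instance Definition _ := @isHermitianSesquilinear.Build (scalars R RealScalars)
  real_line false (@scalar_conj R RealScalars) real_inner real_inner_sym.

Fact real_inner_gt0 (x : real_line) : x != 0 -> 0 < real_inner x x.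
Proof. by move=> x0; rewrite /real_inner /= -expr2 exprn_even_gt0. Qed.

HB.instance Definition _ := @isDotProduct.Build (scalars R RealScalars)
  real_line real_inner real_inner_gt0.

Fact real_inner_norm (x : real_line) :
  (real_inner : {dot real_line for @scalar_conj R RealScalars}) x x = `|x| ^+ 2.
Proof. by rewrite /= /real_inner -expr2 -[LHS]real_normK ?num_real. Qed.

Definition real_hilbert : hilbertType R RealScalars :=
  HB.pack real_line (@CompleteNormedModule_isHilbert.Build R RealScalars
    real_line real_inner real_inner_norm).

End RealLine.

Lemma sup_ge0 (R : realType) (S : set R) : (forall x, S x -> 0 <= x) -> 0 <= sup S.
Proof.
move=> S0; have [hS|hS] := pselect (has_sup S); last by rewrite sup_out.
have [[x Sx] _] := hS; apply: (le_trans (S0 _ Sx)).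
by apply: ub_le_sup => //; case: hS.
Qed.

Lemma Ball_open (R : realType) (s : scalar_kind) (V : normedModType (scalars R s))
  (z : V) (d : R) : open (Ball z d).
Proof.
rewrite openE => x xd; apply/nbhs_BallP; exists (d - normR (x - z)).
  by rewrite subr_gt0.
move=> y; rewrite /Ball /= => yx; have := normRD (y - x) (x - z).
rewrite addrA subrK; lra.
Qed.

Section ScalarMap.
Context {R : realType}.
Local Notation V := (real_hilbert R).
Implicit Types (x : V) (c l : R).

Definition line_map c : V -> V := fun h => c * (h : R).

Lemma normR_line x : normR x = `|x : R|.
Proof. by []. Qed.

Lemma opnorm_line_mapB (A B : V -> V) (c d : R) : A = line_map c -> B = line_map d ->
  opnorm (A \- B) = `|c - d|.
Proof.
move=> -> ->; apply/eqP; rewrite eq_le; apply/andP; split.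
  apply: opnorm_le => // v; rewrite !normR_line /line_map /= -normrM mulrBl.
  by [].
apply: ub_le_sup.
  exists `|c - d| => _ [v /= v1 <-].
  by rewrite -[leLHS]/(`|c * (v : R) - d * (v : R)|) -mulrBl normrM ler_piMr.
have n1 : `|1 : R| <= 1 by rewrite normr1.
exists (1 : R); first exact: n1.
by rewrite -[LHS]/(`|c * 1 - d * 1|) !mulr1.
Qed.

Lemma diff_line (F : V -> V) x l : increment_bound setT (F : R -> R) (x : R) l ->
  differentiable F x /\ 'd F x = line_map l :> (V -> V).
Proof.
move=> /(increment_bound_is_derive (@filterT _ (nbhs (x : R)) _)) dF.
have dF' : differentiable (F : R -> R) (x : R).
  by apply/derivable1_diffP; exact: (@ex_derive _ _ _ _ _ _ _ dF).
split; first exact: dF'.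
apply/funext => h; rewrite /line_map.
have e1 : 'd (F : R -> R) (x : R) 1 = l.
  by rewrite -deriveE //; exact: (@derive_val _ _ _ _ _ _ _ dF).
rewrite -[LHS]/('d (F : R -> R) (x : R) (h : R)).
rewrite -[in LHS](mulr1 (h : R)) -[X in 'd _ _ X]/((h : R) *: (1 : R)) linearZ /= e1.
by rewrite /GRing.scale /= mulrC.
Qed.

End ScalarMap.

Section OddExtension.
Context {R : realType}.
Variables (a kappa : R) (f f' : R -> R).
Hypotheses (a0 : 0 < a) (kappa0 : 0 < kappa) (kappa_a : kappa <= a).
Hypotheses (fC1 : is_C1_ico a f f') (f0 : f 0 = 0) (f'0 : f' 0 = -1).
Hypothesis f'_incr : {in `[0, a[ &, {homo f' : t u / t < u}}.
Local Notation V := (real_hilbert R).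

Definition odd_extension (x : R) : R := if 0 <= x then f x else - f (- x).
Local Notation F := (odd_extension : V -> V).

Let F_pos (x : R) : 0 <= x -> odd_extension x = f x.
Proof. by rewrite /odd_extension => ->. Qed.

Let F_neg (x : R) : x <= 0 -> odd_extension x = - f (- x).
Proof.
rewrite /odd_extension le_eqVlt => /predU1P[->|xn]; last by rewrite leNgt xn.
by rewrite lexx oppr0 f0 oppr0.
Qed.

Lemma odd_extension_increment (x : R) : `|x| < a ->
  increment_bound setT odd_extension x (f' `|x|).
Proof.
move=> xa e e0; have [|d d0 hd] := @majorant_increment _ a f f' fC1 `|x| _ e e0.
  by rewrite normr_ge0.
(* Within [m] of [x], a point [u] stays in the domain and, unless [x] is 0, on the
   same side of 0 as [x]. *)
pose m := Num.min d (Num.min (a - `|x|) (if x == 0 then 1 else `|x|)).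
have m0 : 0 < m.
  by rewrite !lt_min d0 subr_gt0 xa; case: ifPn => x0; [exact: ltr01|rewrite normr_gt0].
exists m => // u _; rewrite !lt_min => /and3P[ud ua us].
have [[x0 u0]|[x0 u0]] : (0 <= x /\ 0 <= u) \/ (x <= 0 /\ u <= 0).
  have [xz|xp|xn] := ltgtP x 0.
  - right; split => //.
    rewrite lt_eqF // (ltr0_norm xz) in us; rewrite leNgt; apply/negP => up.
    by have := ler_norm (u - x); lra.
  - left; split => //.
    rewrite gt_eqF // (gtr0_norm xp) in us; rewrite leNgt; apply/negP => un.
    by have := ler_norm (x - u); rewrite distrC in us; lra.
  - by have [u0|/ltW u0] := leP 0 u; [left|right].
- rewrite !F_pos // ger0_norm // in hd ua *; apply: hd => //.
  by rewrite /= in_itv /= u0; have := ler_norm (u - x); lra.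
- rewrite !F_neg //; rewrite ler0_norm // in hd ua *.
  have uE : - u - - x = - (u - x) by rewrite opprD opprK addrC.
  have := hd (- u); rewrite uE normrN mulrN opprK => h.
  have -> : - f (- u) - - f (- x) - f' (- x) * (u - x) =
    - (f (- u) - f (- x) + f' (- x) * (u - x)) by ring.
  rewrite normrN; apply: h => //.
  by rewrite /= in_itv /= oppr_ge0 u0 /=; have := ler_norm (x - u); rewrite distrC; lra.
Qed.

Lemma odd_extension_diff (x : V) : normR x < a ->
  differentiable F x /\ 'd F x = line_map (f' `|x : R|) :> (V -> V).
Proof. by move=> xa; apply: diff_line; exact: odd_extension_increment. Qed.

Let Ball_lt (x : V) : Ball 0 kappa x -> `|x : R| < kappa.
Proof. by rewrite /Ball /= subr0. Qed.

Let Ball_a (x : V) : Ball 0 kappa x -> normR x < a.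
Proof. by move=> /Ball_lt xk; exact: lt_le_trans kappa_a. Qed.

Lemma line_map_closed_range c : closed (range (line_map c : V -> V)).
Proof.
have [->|c0] := eqVneq c 0.
  suff -> : range (line_map 0 : V -> V) = [set 0] 
    by apply: accessible_closed_set1; apply: hausdorff_accessible; exact: norm_hausdorff.
  apply/seteqP; split=> [_ [v _ <-]|_ ->]; first by rewrite /= /line_map mul0r.
  by exists 0 => //; rewrite /line_map mul0r.
suff -> : range (line_map c : V -> V) = setT by exact: closedT.
apply/seteqP; split=> // y _; exists (c^-1 * (y : R)) => //.
by rewrite /line_map mulVKf.
Qed.

Lemma line_map_inj c : c != 0 -> injective (line_map c : V -> V).
Proof. by move=> c0; exact: mulfI. Qed.

Lemma mp_inverse_line (x y : V) : normR x < a -> f' `|x : R| != 0 ->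
  mp_inverse ('d F x) y = (f' `|x : R|)^-1 * (y : R).
Proof.
move=> xa c0; have [dF dE] := odd_extension_diff xa.
have [C _ hC] := linear_continuous_bounded (diff_continuous dF).
have inj : injective ('d F x) by rewrite dE; exact: line_map_inj.
have {1}-> : y = 'd F x ((f' `|x : R|)^-1 * (y : R)).
  by rewrite dE /line_map mulVKf.
exact: (mp_inverseK hC inj).
Qed.

Lemma majorant_le (t u : R) : 0 <= t -> t <= u -> u < a -> f' t <= f' u.
Proof.
move=> t0; rewrite le_eqVlt => /predU1P[->//|tu] ua.
by apply/ltW/(majorant_deriv_lt f'_incr).
Qed.

Lemma odd_extension_kappa : kappa_of (Ball (0 : V) kappa) 0 a = kappa.
Proof.
pose S := [set t | 0 <= t < a /\ Ball (0 : V) t `<=` Ball (0 : V) kappa].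
have S0 : S !=set0.
  exists 0; split; first by rewrite lexx.
  by move=> x; rewrite /Ball /mkset ltNge normR_ge0.
apply/eqP; rewrite eq_le; apply/andP; split.
  apply: ge_sup => // t [/andP[t0 ta] tk]; rewrite leNgt; apply/negP => kt.
  have /Ball_lt : Ball (0 : V) kappa kappa.
    by apply: tk; rewrite /Ball /mkset subr0 normR_line gtr0_norm.
  by rewrite gtr0_norm // ltxx.
rewrite leNgt; apply/negP => sk.
have s0 : 0 <= kappa_of (Ball (0 : V) kappa) 0 a by apply: sup_ge0 => t [/andP[]].
pose m := (kappa_of (Ball (0 : V) kappa) 0 a + kappa) / 2.
have mk : m < kappa by rewrite /m; lra.
have sm : kappa_of (Ball (0 : V) kappa) 0 a < m by rewrite /m; lra.
have : m <= kappa_of (Ball (0 : V) kappa) 0 a.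
  apply: ub_le_sup; first by exists a => t [/andP[_ /ltW]].
  split; last by move=> x xm; exact: lt_trans mk.
  by rewrite (lt_le_trans mk kappa_a) andbT ltW // (le_lt_trans s0).
by rewrite leNgt sm.
Qed.

(** The differential of the odd extension at [x] is multiplication by
    [f' `|x|], so that the majorant inequality holds with equality. *)
Lemma odd_extension_setting : majorant_setting (Ball (0 : V) kappa) F 0 a f f'.
Proof.
have kE : kappa_of (Ball (0 : V) kappa) 0 a <= kappa by rewrite odd_extension_kappa.
have in0 : Ball (0 : V) kappa 0 by rewrite /Ball /mkset subrr normR0.
have d0 := odd_extension_diff (Ball_a in0).
rewrite normr0 f'0 in d0; have [dF0 dE0] := d0.
split => //.
- exact: Ball_open.
- move=> x xk; have [dFx dEx] := odd_extension_diff (Ball_a xk); split => //.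
  apply/cvgrPdist_le => e e0.
  have xa := Ball_a xk.
  case: fC1 => _ /subspace_continuousP/(_ `|x : R|).
  rewrite /= in_itv /= normr_ge0 => /(_ xa)/cvgrPdist_le/(_ e e0).
  rewrite near_withinE => /nbhs_ballP[d /= d_gt0 hd].
  have : nbhs x (Ball x d `&` Ball (0 : V) kappa).
    apply: filterI; first by apply/nbhs_BallP; exists d.
    by apply: open_nbhs_nbhs; split => //; exact: Ball_open.
  apply: filterS => y [yx yk]; have [_ dEy] := odd_extension_diff (Ball_a yk).
  rewrite (opnorm_line_mapB dEy dEx) sub0r normrN normr_id distrC.
  apply: hd; last by rewrite in_itv /= normr_ge0; exact: Ball_a.
  rewrite -ball_normE /=; apply: le_lt_trans yx.
  by rewrite -[leRHS]/(`|(y : R) - (x : R)|) distrC; exact: ler_dist_dist.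
- move=> x xk; have [_ ->] := odd_extension_diff (Ball_a xk).
  exact: line_map_closed_range.
- by rewrite F_pos.
- by rewrite dE0; apply: line_map_inj; rewrite oppr_eq0 oner_eq0.
- move=> tau x tau01 xk; have {}xk : Ball (0 : V) kappa x by exact: lt_le_trans kE.
  have xa := Ball_a xk; have [tau0 tau1] := andP tau01.
  have nE : normR (x - 0) = `|x : R| by rewrite subr0.
  pose y : V := tau * (x : R).
  have -> : 0 + scalar_of_real RealScalars tau *: (x - 0) = y.
    by rewrite subr0 add0r.
  have yE : `|y : R| = tau * `|x : R| by rewrite normrM ger0_norm.
  have yx : `|y : R| <= `|x : R| by rewrite yE ler_piMl.
  have yk : Ball (0 : V) kappa y.
    by rewrite /Ball /mkset subr0; apply: le_lt_trans yx (Ball_lt xk).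
  have [_ dEx] := odd_extension_diff xa; have [_ dEy] := odd_extension_diff (Ball_a yk).
  rewrite (opnorm_line_mapB dEx dEy) nE -yE.
  have le0 : 0 <= f' `|x : R| - f' `|y : R| by rewrite subr_ge0; exact: majorant_le.
  rewrite (ger0_norm le0) ler_piMl //.
  apply: opnorm_le => // v; rewrite mul1r mp_inverse_line ?normR0 //; last first.
    by rewrite normr0 f'0 oppr_eq0 oner_eq0.
  by rewrite normr0 f'0 invrN1 mulN1r normR_line normrN.
Qed.

Section Oscillation.
Variable t : R.
Hypotheses (t0 : 0 < t) (tk : t < kappa) (ft : f t / f' t = 2 * t).

Let f't : f' t != 0.
Proof.
apply/negP => /eqP h; move: ft; rewrite h invr0 mulr0 => /esym/eqP.
by rewrite mulf_eq0 pnatr_eq0 /= gt_eqF.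
Qed.

(** [t - f t / f' t = - t], and by oddness the step from [- t] leads back to [t]. *)
Lemma gauss_newton_oscillates k :
  gauss_newton F (t : V) k = (if odd k then - t else t) :> R.
Proof.
elim: k => // k IH; rewrite /gauss_newton iterS -/(gauss_newton F (t : V) k).
set x := gauss_newton F (t : V) k in IH *.
have xt : `|x : R| = t by rewrite IH; case: ifP => _; rewrite ?normrN gtr0_norm.
have xa : normR x < a by rewrite normR_line xt (lt_le_trans tk).
rewrite -[LHS]/((x : R) - mp_inverse ('d F x) (F x)).
rewrite mp_inverse_line ?xt // IH /=; case: ifP => _ /=.
  rewrite F_neg ?oppr_le0 ?ltW // opprK mulrN opprK mulrC ft; lra.
by rewrite F_pos ?ltW // mulrC ft; lra.
Qed.

Lemma oscillation_well_defined :
  gauss_newton_well_defined (Ball (0 : V) kappa) F (t : V).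
Proof.
move=> k; set x := gauss_newton F (t : V) k.
have xt : `|x : R| = t.
  by rewrite /x gauss_newton_oscillates; case: ifP => _; rewrite ?normrN gtr0_norm.
have xk : Ball (0 : V) kappa x by rewrite /Ball /mkset subr0 normR_line xt.
split => //; have [_ ->] := odd_extension_diff (Ball_a xk).
by apply: line_map_inj; rewrite xt.
Qed.

Lemma oscillation_not_cvg : ~ cvgn (gauss_newton F (t : V)).
Proof.
move=> /cvg_ex[l /cvgn_normRP/(_ t t0)[N hN]].
pose p : R := gauss_newton F (t : V) N; pose q : R := gauss_newton F (t : V) N.+1.
have h1 : `|p - (l : R)| < t := hN N (leqnn N).
have h2 : `|q - (l : R)| < t := hN N.+1 (leqnSn N).
have h3 : `|p - q| = 2 * t.
  have [pE qE] : p = (if odd N then - t else t) /\ q = (if odd N.+1 then - t else t).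
    by split; exact: gauss_newton_oscillates.
  have tt : t + t = 2 * t by ring.
  rewrite pE qE /=; case: odd => /=; last by rewrite opprK gtr0_norm ?addr_gt0.
  by rewrite -opprD normrN gtr0_norm ?addr_gt0.
have := ler_distD (l : R) p q; rewrite (distrC (l : R)); lra.
Qed.

End Oscillation.

End OddExtension.

(** * The convergence theorem *)

Theorem theorem2 (R : realType) (s : scalar_kind) (X Y : hilbertType R s)
    (Omega : set X) (F : X -> Y) (xs : X) (a : R) (f f' : R -> R)
    (hyp : majorant_setting Omega F xs a f f') :
  let kappa := kappa_of Omega xs a in
  let nu := nu_of a f' in
  let rho := rho_of a f f' in
  let r := Num.min kappa rho in
  let sigma := sigma_of kappa f in
  (forall x0 : X, Ball xs r x0 -> x0 <> xs ->
     let t0 := normR (x0 - xs) in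
     let x_ := gauss_newton F x0 in
     let t_ := majorant_seq f f' t0 in
     [/\ gauss_newton_well_defined Omega F x0,
         majorant_seq_well_defined a f f' t0,
         (forall k, t_ k.+1 < t_ k),
         (forall k, 0 < t_ k < r) &
         t_ k @[k --> \oo] --> (0 : R)] /\
     [/\ (forall k, Ball xs r (x_ k)),
         x_ k @[k --> \oo] --> xs,
         [set x | Ball xs sigma x /\ F x = 0] = [set xs],
         normR (x_ k.+1 - xs) / normR (x_ k - xs) @[k --> \oo] --> (0 : R) &
         t_ k.+1 / t_ k @[k --> \oo] --> (0 : R)] /\
     (forall p : R, 0 <= p <= 1 ->
        {in `]0, nu[ &,
           {homo (fun t => (f t / f' t - t) / t `^ (p + 1)) : t u / t < u}} ->
        [/\ (forall k, t_ k.+2 / t_ k.+1 `^ (p + 1) < t_ k.+1 / t_ k `^ (p + 1)),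
            (forall k,
               normR (x_ k.+1 - xs)
                 <= t_ k.+1 / t_ k `^ (p + 1) * normR (x_ k - xs) `^ (p + 1)
                 <= t_ 1%N / t0 `^ (p + 1) * normR (x_ k - xs) `^ (p + 1)),
            (p = 0 -> forall k, normR (x_ k - xs) <= t0 * (t_ 1%N / t0) ^+ k) &
            (p <> 0 -> forall k, normR (x_ k - xs)
               <= t0 * (t_ 1%N / t0) `^ (((p + 1) ^+ k - 1) / p))])) /\
  (f rho / (rho * f' rho) - 1 = 1 -> rho < kappa ->
     r = rho /\
     exists (s' : scalar_kind) (X' Y' : hilbertType R s') (Omega' : set X')
       (F' : X' -> Y') (xs' x0' : X'),
       [/\ majorant_setting Omega' F' xs' a f f',
           kappa_of Omega' xs' a = kappa,
           normR (x0' - xs') = rho,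
           gauss_newton_well_defined Omega' F' x0' &
           ~ cvgn (gauss_newton F' x0')]).
Proof.
move=> kappa nu rho r sigma; split=> [x0 x0r x0n t0 x_ t_|rho2 rhok].
  split; first split.
  - exact: (gauss_newton_is_well_defined hyp x0r x0n).
  - exact: (majorant_seq_is_well_defined hyp x0r x0n).
  - exact: (majorant_seq_decr hyp x0r x0n).
  - exact: (majorant_seq_itv hyp x0r x0n).
  - exact: (majorant_seq_cvg hyp x0r x0n).
  split; first split.
  - by move=> k; have [] := gauss_newton_lt hyp x0r x0n k.
  - exact: (gauss_newton_cvg hyp x0r x0n).
  - exact: (zeros_in_ball hyp x0r x0n).
  - exact: (gauss_newton_superlinear hyp x0r x0n).
  - exact: (majorant_seq_superlinear hyp x0r x0n).
  move=> p p01 h3; split.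
  - exact: (rate_decr hyp x0r x0n h3).
  - exact: (rate_le hyp x0r x0n p01 h3).
  - exact: (rate_linear hyp x0r x0n p01 h3).
  - exact: (rate_power hyp x0r x0n p01 h3).
split; first by apply/min_idPr; exact: ltW.
have rho0 : 0 < rho.
  rewrite lt_def; apply/andP; split; last first.
    by apply: sup_ge0 => d [/andP[/ltW]].
  (* As division by 0 gives 0, [rho = 0] would turn [rho2] into -1 = 1. *)
  apply/eqP => h; move: rho2; rewrite h !(mul0r, invr0, mulr0); lra.
have step : f rho / f' rho = 2 * rho.
  move: rho2; rewrite invfM mulrCA mulrC => h.
  have -> : f rho / f' rho = (f rho / f' rho / rho) * rho by rewrite divfK // gt_eqF.
  by congr (_ * _); lra.
have [f0 f'0] := ms_h1 hyp.
have kappa0 : 0 < kappa := lt_trans rho0 rhok.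
have kappa_a : kappa <= a := kappa_le hyp.
pose F' := odd_extension f : real_hilbert R -> real_hilbert R.
exists RealScalars, (real_hilbert R), (real_hilbert R), (Ball 0 kappa), F', 0, rho.
split.
- exact: (odd_extension_setting (ms_radius_gt0 hyp) kappa0 kappa_a (ms_majorant_C1 hyp)
    f0 f'0 (ms_h2 hyp)).
- by apply: odd_extension_kappa => //; exact: ms_radius_gt0 hyp.
- by rewrite subr0 normR_line gtr0_norm.
- exact: (oscillation_well_defined kappa_a (ms_majorant_C1 hyp) f0 rho0 rhok step).
- exact: (oscillation_not_cvg kappa_a (ms_majorant_C1 hyp) f0 rho0 rhok step).
Qed.
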